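(* Let $(X,d,\mu)$ be an $(\alpha,\beta)$-regular metric measure space, where $\alpha,\beta>0$. Let $Q\subset X$ be a WDS subset of $X$ with radius function $R:Q\to\mathbb{R}_+$. Let $\psi:(0,\infty)\to(0,\infty)$ be a non-decreasing function such that the series $\sum_{\xi\in Q}\left(\frac{\psi(R(\xi))}{R(\xi)}\right)^{\alpha}$ converges. Then $$\dim E_{\psi}(Q,R)=\dim W_{\psi}(Q,R)=\frac{\alpha}{\underline{\lambda}(\psi)},$$ where $\dim$ denotes Hausdorff dimension.
   Context: A Borel measure $\mu$ on a metric space $(X,d)$ is $(\alpha,\beta)$-regular ($\alpha,\beta>0$) if there is $C>0$ such that for every ball $B=B(\xi,r)\subset X$ and every annulus $A(\xi,r,R):=\overline{B}(\xi,R)\setminus B(\xi,r)$ with $0\le r\le R\le \mathrm{diam}(X)$: (1) (Ahlfors regularity) $r^\alpha/C\le\mu(B)\le C r^\alpha$; (2) (annular regularity) $\frac1C r^\alpha\left(\frac{R-r}{r}\right)^\beta\le \mu(A(\xi,r,R))$. The space is $\alpha$-Ahlfors regular if (1) holds. For an $\alpha$-Ahlfors regular metric measure space $(X,d,\mu)$, a countable subset $Q\subset X$ is WDS with radius function $R:Q\to\mathbb{R}_+$ if there exists a constant $C\ge1$ such that: (1) (well-separated) for all $\xi,\zeta\in Q$, $d(\xi,\zeta)\ge \frac1C\min\{R(\xi),R(\zeta)\}$; (2) (well-distributed) for each ball $B=B(\eta,r)\subset X$ there is $k_B\in\mathbb{N}$ such that for each $k\ge k_B$ there is a subset $Q_B(k)\subset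 Q$ with (a) $1/(Ck)\le R(\xi)\le C/k$ for all $\xi\in Q_B(k)$, (b) $\bigcup_{\xi\in Q_B(k)}B(\xi,R(\xi))\subset B$, (c) $\#Q_B(k)\ge \frac1C k^\alpha\mu(B)$. For a countable $Q\subset X$, $R:Q\to\mathbb{R}_+$ and $\psi$, define $W_\psi(Q,R):=\{x\in X: d(x,\xi)<\psi(R(\xi))\text{ for infinitely many }\xi\in Q\}$ and $E_\psi(Q,R):=W_\psi(Q,R)\setminus\bigcup_{0<c<1}W_{c\psi}(Q,R)$. The lower order at zero of $\psi$ is $\underline{\lambda}(\psi):=\liminf_{x\to0}\frac{\log\psi(x)}{\log x}$.
   Formalization: The formal theorem additionally assumes that X is complete, that the measure μ is nonzero, and that the radius function R is bounded on Q (automatic when X is bounded); without any one of these the claim as stated has counterexamples. *)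

(* Defs.v *)
From HB Require Import structures.
From mathcomp Require Import all_boot all_order all_algebra.
From mathcomp Require Import all_classical all_reals all_analysis.

Set Implicit Arguments.
Unset Strict Implicit.
Unset Printing Implicit Defensive.

Import Order.TTheory GRing.Theory Num.Theory.
Import numFieldNormedType.Exports.

Local Open Scope classical_set_scope.
Local Open Scope ring_scope.

(* The library's measurable types are pointed, whence the base point. *)
#[short(type="pmetricType")]
HB.structure Definition PMetric (K : numDomainType) :=
  {M of Pointed M & Metric K M}.

Notation borel X := (g_sigma_algebraType (@open X)).

Section hausdorff_dimension.
Context {R : realType} {X : metricType R}.
Implicit Types (A U : set X) (s delta : R).
Local Open Scope ereal_scope.

(* The summand 0 is there so that diam set0 = 0 instead of -oo. *)
Definition diam A : \bar R :=
  ereal_sup ([set 0] `|` [set (mdist z.1 z.2)%:E | z in A `*` A]).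

(* Empty sets weigh 0 for s = 0 too, where poweR gives 0 `^ 0 = 1. *)
Definition diam_pow s U : \bar R := if U == set0 then 0 else diam U `^ s.

Definition hausdorff_content s delta A : \bar R :=
  ereal_inf [set \sum_(0 <= i <oo) diam_pow s (U i) |
    U in [set U : (set X)^nat |
      A `<=` \bigcup_i U i /\ forall i, diam (U i) <= delta%:E]].

Definition hausdorff_measure s A : \bar R :=
  ereal_sup [set hausdorff_content s delta A | delta in [set d : R | (0 < d)%R]].

Definition hausdorff_dim A : \bar R :=
  ereal_inf [set s%:E | s in [set s : R | (0 <= s)%R /\ hausdorff_measure s A = 0]].

End hausdorff_dimension.

Section regularity.
Context {R : realType} {X : pmetricType R}.
Variable mu : {measure set (borel X) -> \bar R}.
Implicit Types (alpha beta C : R) (xi : X) (r s : R).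

(* The closed ball is {d <= s}; the library's [closed_ball] is the closure of
   the open ball, which can be smaller in a metric space. *)
Definition annulus xi r s : set X :=
  [set y : X | mdist xi y <= s] `\` ball xi r.

Definition ahlfors_bounds alpha C : Prop :=
  forall xi r, 0 <= r -> (r%:E <= diam [set: X])%E ->
    ((r `^ alpha / C)%:E <= mu (ball xi r))%E /\
    (mu (ball xi r) <= (C * r `^ alpha)%:E)%E.

(* For r = 0, (s - r) / r is undefined on paper; here s / 0 = 0 makes the
   inequality hold trivially. *)
Definition annular_bounds alpha beta C : Prop :=
  forall xi r s, 0 <= r -> r <= s -> (s%:E <= diam [set: X])%E ->
    ((C^-1 * r `^ alpha * ((s - r) / r) `^ beta)%:E <= mu (annulus xi r s))%E.

Definition regular alpha beta : Prop :=
  exists C : R, [/\ 0 < C, ahlfors_bounds alpha C & annular_bounds alpha beta C].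

Implicit Types (Q : set X) (rad : X -> R).

(* [rad] stands for the radius function on Q; its values off Q are never used. *)
Definition well_separated Q rad C : Prop :=
  forall xi zeta, Q xi -> Q zeta -> xi <> zeta ->
    C^-1 * Num.min (rad xi) (rad zeta) <= mdist xi zeta.

Definition well_distributed alpha Q rad C : Prop :=
  forall (eta : X) (r : R), 0 < r ->
  exists2 kB : nat, (0 < kB)%N & forall k : nat, (kB <= k)%N ->
  exists QB : set X,
    [/\ QB `<=` Q,
        forall xi, QB xi -> (C * k%:R)^-1 <= rad xi <= C / k%:R,
        \bigcup_(xi in QB) ball xi (rad xi) `<=` ball eta r
      & ((C^-1 * k%:R `^ alpha)%:E * mu (ball eta r) <= counting QB)%E].

Definition WDS alpha Q rad : Prop :=
  exists C : R,
    [/\ 1 <= C, well_separated Q rad C & well_distributed alpha Q rad C].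

End regularity.

Section approximation.
Context {R : realType} {X : metricType R}.
Variables (Q : set X) (rad : X -> R).
Implicit Type psi : R -> R.

Definition Wset psi : set X :=
  [set x | infinite_set [set xi | Q xi /\ mdist x xi < psi (rad xi)]].

Definition Eset psi : set X :=
  Wset psi `\`
    \bigcup_(c in [set c : R | 0 < c < 1]) Wset (fun t => c * psi t).

End approximation.

Definition lower_order {R : realType} (psi : R -> R) : \bar R :=
  limf_einf (fun x : R => (ln (psi x) / ln x)%:E) (0 : R)^'+.

(* Main.v *)
(* Upper bound: for l below the lower order, psi t <= t ^ l near 0. At scale t a
   ball of radius comparable to diam X contains O(t ^ - alpha) points of Q,
   because they are separated, so the balls B(xi, psi (rad xi)) with small rad xi
   give covers of W_psi with arbitrarily small s-sum as soon as l s > alpha.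

   Lower bound: let s < alpha / lambda and let sets U_i of diameters at most d_i
   be such that the sum of the d_i ^ s is small. We find a point of E_psi outside
   all U_i, whence H^s(E_psi) > 0, without constructing a Cantor measure. Keep a
   ball B(y, r) such that the U_i meeting it satisfy sum d_i ^ s <= kappa r ^ s
   and such that the points zeta not yet avoided, those with rad zeta <= t,
   satisfy sum psi (rad zeta) ^ alpha <= kappa r ^ alpha. At a scale x0 with
   psi x0 >= x0 ^ l, s l < alpha, the ball contains about (r / x0) ^ alpha
   well-separated points xi. By packing, at most half of the balls
   B(xi, psi (rad xi)) meet a U_i, or a ball B(zeta, psi (rad zeta)), of size at
   least comparable to x0. Each smaller U_i meets at most one of the others, so
   averaging yields xi for which the first bound holds, with room to spare when
   x0 is tiny, in B(xi, psi (rad xi)). The next ball is placed in the annulus of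
   relative width 1 / (m + 1) inside the sphere of radius psi (rad xi) around xi;
   the second bound persists because the tails of the given series tend to 0. The
   limit point is approximated by the successive xi, at distances asymptotic to
   psi (rad xi), and by no other point of Q with small radius. *)
Require Import Defs.
From mathcomp Require Import all_boot all_order all_algebra finmap.
From mathcomp Require Import all_classical all_reals all_analysis.
From mathcomp Require Import ring lra.
Import Order.TTheory GRing.Theory Num.Theory.
Import numFieldNormedType.Exports.
Local Open Scope classical_set_scope.
Local Open Scope ring_scope.

(* Infinite sums of nonnegative terms are bounded through their finite subsums, so
   that the estimates stay in [R]. *)
Definition sums_le {R : realType} {T : choiceType} (A : set T) (f : T -> R)
    (b : R) : Prop :=
  forall F : {fset T}, (forall x, x \in F -> A x) -> \sum_(x <- F) f x <= b.

Lemma powR_div {R : realType} {x y : R} (a : R) : 0 <= x -> 0 <= y ->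
  (x / y) `^ a = x `^ a / y `^ a.
Proof.
move=> x0 y0; rewrite powRM ?invr_ge0//.
by rewrite -(powR_inv1 y0) -powRrM mulN1r powRN.
Qed.

Section halving.
Set Implicit Arguments.
Unset Strict Implicit.
Context {R : realType} (u : nat -> R).
Context (u_gt0 : forall n, 0 < u n) (u_half : forall n, u n.+1 <= u n / 2).

Lemma halving_decr m n : (m <= n)%N -> u n <= u m.
Proof.
elim: n => [|n ih]; first by rewrite leqn0 => /eqP ->.
rewrite leq_eqVlt => /orP[/eqP ->//|/ih h].
by have := u_half n; have := u_gt0 n; lra.
Qed.

Lemma halving_lt e : 0 < e -> exists n, u n < e.
Proof.
move=> e0; have h n : u n * n.+1%:R <= u 0%N.
  elim: n => [|n ih]; first by rewrite mulr1.
  apply: le_trans ih; apply: le_trans (ler_wpM2r (ler0n _ _) (u_half n)) _.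
  rewrite -mulrA ler_pM2l// -[n.+2%:R]natr1.
  have : 1 <= n.+1%:R :> R by rewrite ler1n.
  lra.
exists (Num.truncn (u 0%N / e)).
have := h (Num.truncn (u 0%N / e)); rewrite -ler_pdivlMr// => h'.
apply: le_lt_trans h' _; rewrite ltr_pdivrMr// mulrC -ltr_pdivrMr//.
exact: truncnS_gt.
Qed.

End halving.

Section finite_sums.
Set Implicit Arguments.
Unset Strict Implicit.
Context {R : realType} {T : choiceType}.
Implicit Types (A B : set T) (f g : T -> R) (b c : R).

Lemma sum_fset_const (F : {fset T}) c : \sum_(x <- F) c = c * #|` F|%:R.
Proof. by rewrite big_const_seq count_predT iter_addr addr0 mulr_natr. Qed.

Lemma big_fsetU_disjoint (F G : {fset T}) f : (forall x, x \in F -> x \notin G) ->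
  \sum_(x <- (F `|` G)%fset) f x = \sum_(x <- F) f x + \sum_(x <- G) f x.
Proof.
move=> FG; rewrite (perm_big (F ++ G)) ?big_cat//=.
apply: uniq_perm; rewrite ?cat_uniq ?fset_uniq//= ?andbT.
  by apply/hasPn => x xG; apply/negP => /FG; rewrite xG.
by move=> x; rewrite mem_cat inE.
Qed.

Lemma sums_le_esum A f b : (forall x, A x -> 0 <= f x) ->
  sums_le A f b <-> (\esum_(x in A) (f x)%:E <= b%:E)%E.
Proof.
move=> f0; split=> [h|h F FA].
- apply: ge_ereal_sup => _ [F [finF FA] <-].
  rewrite fsbig_finite//= sumEFin lee_fin; apply: h => x.
  by rewrite in_fset_set// inE => /FA.
- rewrite -lee_fin -sumEFin; apply: le_trans h; apply: esum_ge.
  exists [set` F]; first by split => [|x /= /FA].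
  by rewrite fsbig_finite//= set_fsetK.
Qed.

Lemma sums_leS A B f b c : B `<=` A -> b <= c -> sums_le A f b -> sums_le B f c.
Proof.
by move=> BA bc h F FB; apply: le_trans bc; apply: h => x /FB/BA.
Qed.

Lemma sums_le_term A f b x : sums_le A f b -> A x -> f x <= b.
Proof.
move=> h Ax; have := h [fset x]%fset; rewrite big_seq_fset1; apply=> y.
by rewrite inE => /eqP ->.
Qed.

Lemma sums_le_ge0 A f b : sums_le A f b -> 0 <= b.
Proof. by move=> /(_ fset0); rewrite big_seq_fset0; apply. Qed.

Lemma sums_leM A f g b c : 0 <= c ->
  (forall x, A x -> f x <= c * g x) -> sums_le A g b -> sums_le A f (c * b).
Proof.
move=> c0 fg h F FA; apply: (@le_trans _ _ (\sum_(x <- F) c * g x)).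
  by rewrite big_seq [leRHS]big_seq; apply: ler_sum => x /FA/fg.
by rewrite -mulr_sumr ler_wpM2l// h.
Qed.

Lemma fset_gt0_lower (F : {fset T}) f : (forall x, x \in F -> 0 < f x) ->
  exists2 t, 0 < t & forall x, x \in F -> t < f x.
Proof.
move=> f0; exists (\big[Order.min/1]_(x <- F) (f x / 2)).
  rewrite big_seq; apply: (big_ind (fun y => 0 < y)) => [||x xF]; first exact: ltr01.
    by move=> x y x0 y0; rewrite lt_min x0 y0.
  by rewrite divr_gt0//; exact: f0.
move=> x xF; apply: (@le_lt_trans _ _ (f x / 2)); first exact: ge_bigmin_seq.
by have := f0 _ xF; lra.
Qed.

Lemma sums_le_tail A f b (rad : T -> R) : (forall x, A x -> 0 <= f x) ->
  (forall x, A x -> 0 < rad x) -> sums_le A f b ->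
  forall e, 0 < e -> exists2 t, 0 < t &
    sums_le [set x | A x /\ rad x <= t] f e.
Proof.
move=> f0 rad0 h e e0.
pose S := [set \sum_(x <- F) f x | F in [set F : {fset T} | forall x, x \in F -> A x]].
have supS : has_sup S.
  split; first by exists (\sum_(x <- fset0) f x); exists fset0.
  by exists b => _ [F FA <-]; exact: h.
have [_ [F0 /= F0A <-] ltF0] := sup_adherent e0 supS.
have [x xF|t t0 tF] := fset_gt0_lower (F := F0) (f := rad).
  by apply: rad0; apply: F0A.
exists t => // F FA.
have : \sum_(x <- (F0 `|` F)%fset) f x <= sup S.
  apply: ub_le_sup; first by case: supS.
  exists (F0 `|` F)%fset => //= x; rewrite inE => /orP[/F0A//|/FA[]//].
rewrite big_fsetU_disjoint; first by lra.
move=> x xF0; apply/negP => /FA[_]; rewrite leNgt.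
by move: (tF _ xF0) => ->.
Qed.

Lemma sums_le_disjoint {I : choiceType} A f b (G : {fset I}) (J : I -> {fset T}) :
  sums_le A f b -> (forall x i, x \in G -> i \in J x -> A i) ->
  (forall x y i, x \in G -> y \in G -> i \in J x -> i \in J y -> x = y) ->
  \sum_(x <- G) \sum_(i <- J x) f i <= b.
Proof.
move=> h JA disJ.
suff: forall s : seq I, uniq s -> {subset s <= G} -> exists K : {fset T},
    (forall i, i \in K -> exists2 x, x \in s & i \in J x) /\
    \sum_(i <- K) f i = \sum_(x <- s) \sum_(i <- J x) f i.
  move=> /(_ G (fset_uniq G)) [//|K [KP <-]].
  by apply: h => i /KP[x xG]; exact: JA.
elim=> [|x s ih] /=; first by move=> _ _; exists fset0; rewrite big_nil big_seq_fset0.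
move=> /andP[xs us] sG.
have [|K [KP sumK]] := ih us.
  by move=> y ys; apply: sG; rewrite inE ys orbT.
exists (J x `|` K)%fset; split.
  move=> i; rewrite inE => /orP[iJ|/KP[y ys iJ]].
    by exists x => //; rewrite inE eqxx.
  by exists y => //; rewrite inE ys orbT.
rewrite big_cons -sumK big_fsetU_disjoint// => i iJ; apply/negP => /KP[y ys iJy].
have xy : x = y.
  by apply: (disJ _ _ i) => //; apply: sG; rewrite inE ?eqxx ?ys ?orbT.
by move: xs; rewrite xy ys.
Qed.

Lemma sums_le_finite A f b c : 0 < c -> (forall x, A x -> c <= f x) ->
  sums_le A f b -> finite_set A.
Proof.
move=> c0 cf h; apply: contrapT => /infinite_set_fsetP infA.
have [F FA sF] := infA (Num.truncn (b / c)).+1.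
have : \sum_(x <- F) f x <= b by apply: h => x /FA.
apply/negP; rewrite -ltNge; apply: (@lt_le_trans _ _ (\sum_(x <- F) c)); last first.
  by rewrite big_seq [leRHS]big_seq; apply: ler_sum => x /FA/cf.
rewrite sum_fset_const mulrC -ltr_pdivrMr//.
by apply: (lt_le_trans (truncnS_gt _)); rewrite ler_nat.
Qed.

Lemma sums_le_reindex {I : choiceType} A f b (B : set I) (g : I -> T) :
  (forall i, B i -> A (g i)) ->
  (forall i j, B i -> B j -> g i = g j -> i = j) ->
  sums_le A f b -> sums_le B (fun i => f (g i)) b.
Proof.
move=> BA inj h F FB.
have -> : \sum_(i <- F) f (g i) = \sum_(x <- (g @` F)%fset) f x.
  by rewrite big_imfset//= => i j /FB Bi /FB Bj; exact: inj.
by apply: h => _ /imfsetP[i /= iF ->]; apply: BA; exact: FB.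
Qed.

Lemma sums_le_support A f b : 0 <= b -> (forall x, ~ A x -> f x = 0) ->
  sums_le A f b -> sums_le [set: T] f b.
Proof.
move=> b0 f0 h F _; rewrite (bigID (fun x => `[< A x >]))/=.
rewrite [X in _ + X]big1 ?addr0; last by move=> x /asboolPn/f0.
by rewrite big_fset_condE; apply: h => x; rewrite !inE/= => /andP[_ /asboolP].
Qed.

Lemma sums_le_bigcup {I : choiceType} (K : set I) (A : I -> set T) f
    (e : I -> R) b :
  (forall i, K i -> sums_le (A i) f (e i)) -> sums_le K e b ->
  sums_le (\bigcup_(i in K) A i) f b.
Proof.
move=> hA hK F FA; have [->|[x0 x0F]] := fset_0Vmem F.
  by rewrite big_seq_fset0; have := hK fset0; rewrite big_seq_fset0; apply.
have [i0 _ _] := FA _ x0F.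
have [j jP] : {j : T -> I & forall x, x \in F -> K (j x) /\ A (j x) x}.
  apply: (choice (P := fun x i => x \in F -> K i /\ A i x)) => x.
  have [/FA[i Ki Ai]|] := boolP (x \in F); first by exists i.
  by exists i0.
rewrite (partition_big_imfset _ j)/=.
apply: (@le_trans _ _ (\sum_(i <- (j @` F)%fset) e i)); last first.
  by apply: hK => _ /imfsetP[x /= /jP[Kx _] ->].
rewrite big_seq [leRHS]big_seq; apply: ler_sum => _ /imfsetP[x /= xF ->].
rewrite big_fset_condE; apply: (hA _ (jP _ xF).1) => y.
by rewrite !inE/= => /andP[/jP[_ h] /eqP <-].
Qed.

End finite_sums.

Section series_of_reals.
Set Implicit Arguments.
Unset Strict Implicit.
Context {R : realType}.
Implicit Types (f : nat -> R) (b : R).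

Lemma sums_le_nat f b : (forall n, 0 <= f n) ->
  (forall n, \sum_(0 <= i < n) f i <= b) -> sums_le [set: nat] f b.
Proof.
move=> f0 h F _; pose n := (\max_(k <- F) k).+1.
apply: le_trans (h n); rewrite -lee_fin -!sumEFin.
apply: (@lee_sum_fset_nat _ (fun i => (f i)%:E) F n xpredT) => [k _|k kF].
  by rewrite lee_fin.
by rewrite /= /n big_seq_fsetE/= -[k]/(val [` kF]%fset) ltnS leq_bigmax.
Qed.

Lemma sums_le_nneseries f b : (forall n, 0 <= f n) ->
  sums_le [set: nat] f b <-> (\sum_(0 <= i <oo) (f i)%:E <= b%:E)%E.
Proof.
move=> f0; rewrite nneseries_esumT; last by move=> n; rewrite lee_fin.
by apply: sums_le_esum => n _.
Qed.

Lemma sums_le_geometric (q : R) : 0 < q -> q < 1 ->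
  sums_le [set: nat] (fun n => q ^+ n) (1 - q)^-1.
Proof.
move=> q0 q1; have q10 : 0 < 1 - q by rewrite subr_gt0.
apply: sums_le_nat => n; first by rewrite exprn_ge0// ltW.
rewrite -[leRHS]mul1r ler_pdivlMr//.
have -> : (\sum_(0 <= i < n) q ^+ i) * (1 - q) = 1 - q ^+ n.
  elim: n => [|n ih]; first by rewrite big_nil mul0r expr0 subrr.
  by rewrite big_nat_recr//= mulrDl ih exprS; ring.
by rewrite gerBl exprn_ge0// ltW.
Qed.

End series_of_reals.

Section packing.
Set Implicit Arguments.
Unset Strict Implicit.
Context {R : realType} {X : pmetricType R}.
Context (mu : {measure set (borel X) -> \bar R}) (alpha C D : R).
Context (C_gt0 : 0 < C).
Context (ahl : forall (xi : X) (r : R), 0 <= r -> r <= D ->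
  ((r `^ alpha / C)%:E <= mu (ball xi r))%E /\
  (mu (ball xi r) <= (C * r `^ alpha)%:E)%E).

Lemma measurable_ball_borel (x : X) (r : R) : measurable (ball x r : set (borel X)).
Proof.
apply: sub_sigma_algebra; rewrite openE => y; rewrite ballEmdist/= => xy.
rewrite /interior -nbhs_ballE; exists (r - mdist x y); first by rewrite /= subr_gt0.
move=> z; rewrite !ballEmdist/= => yz.
by apply: (le_lt_trans (metric_triangle _ y _)); rewrite -ltrBrDl.
Qed.

Lemma packing (F : {fset X}) (v : X) (e t : R) :
  0 < e -> e <= D -> 0 <= t -> t <= D ->
  (forall x y, x \in F -> y \in F -> x <> y -> 2 * e <= mdist x y) ->
  (forall x, x \in F -> ball x e `<=` ball v t) ->
  #|` F|%:R * e `^ alpha <= C ^+ 2 * t `^ alpha.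
Proof.
move=> e0 eD t0 tD sepF Fv.
have mF x : x \in F -> measurable (ball x e : set (borel X)).
  by move=> _; exact: measurable_ball_borel.
have disF : trivIset [set` F] (fun x : X => ball x e : set (borel X)).
  move=> x y /= xF yF [z []]; rewrite !ballEmdist/= => xz yz.
  apply: contrapT => xy; have := sepF _ _ xF yF xy.
  apply/negP; rewrite -ltNge; apply: (le_lt_trans (metric_triangle _ z _)).
  by rewrite (metric_sym z); lra.
have := measure_fbigsetU mu mF disF.
move=> muE.
have : (\sum_(x <- F) (e `^ alpha / C)%:E <= (C * t `^ alpha)%:E)%E.
  apply: le_trans (ahl v t0 tD).2.
  apply: (@le_trans _ _ (\sum_(x <- F) mu (ball x e))%E).
    by apply: lee_sum => x _; apply: (ahl x (ltW e0) eD).1.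
  rewrite -muE le_measure ?inE//.
  - by rewrite -bigcup_fset; apply: fin_bigcup_measurable.
  - exact: measurable_ball_borel.
  - by rewrite -bigcup_fset => z [x xF]; exact: Fv.
rewrite sumEFin lee_fin sum_fset_const -mulrA [_^-1 * _]mulrC mulrA.
by rewrite ler_pdivrMr// mulrC => h; apply: le_trans h _; lra.
Qed.

Lemma packing_cover {T : choiceType} (I : set T) (v : T -> X) (s : T -> R)
    (b e : R) (F : {fset X}) :
  0 < e -> e <= D ->
  (forall i, I i -> 0 <= s i /\ 4 * s i <= D) ->
  sums_le I (fun i => s i `^ alpha) b ->
  (forall x y, x \in F -> y \in F -> x <> y -> 2 * e <= mdist x y) ->
  (forall x, x \in F -> exists2 i, I i & ball x e `<=` ball (v i) (4 * s i)) ->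
  #|` F|%:R * e `^ alpha <= C ^+ 2 * 4 `^ alpha * b.
Proof.
move=> e0 eD sD sumI sepF hitF.
have [->|[x0 x0F]] := fset_0Vmem F.
  rewrite cardfs0 mul0r mulr_ge0//; last exact: sums_le_ge0 sumI.
  by rewrite mulr_ge0 ?powR_ge0 ?sqr_ge0.
have [i0 _ _] := hitF _ x0F.
have [j jP] : {j : X -> T & forall x, x \in F ->
    I (j x) /\ ball x e `<=` ball (v (j x)) (4 * s (j x))}.
  apply: (@choice X T (fun x i => x \in F ->
    I i /\ ball x e `<=` ball (v i) (4 * s i))) => x.
  have [xF|xF] := boolP (x \in F); last by exists i0.
  by have [i Ii xi] := hitF _ xF; exists i.
rewrite mulrC -sum_fset_const (partition_big_imfset _ j)/=.
apply: (@le_trans _ _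
    (\sum_(i <- (j @` F)%fset) C ^+ 2 * 4 `^ alpha * s i `^ alpha)); last first.
  rewrite -mulr_sumr ler_wpM2l ?(mulr_ge0 (sqr_ge0 C)) ?powR_ge0//.
  by apply: sumI => _ /imfsetP[x /= xF ->]; apply: (jP _ xF).1.
rewrite big_seq [leRHS]big_seq; apply: ler_sum => _ /imfsetP[x0' /= x0'F ->].
set i := j x0'.
have [Ii _] := jP _ x0'F; have [s0 s4] := sD _ Ii.
have -> : \sum_(x <- F | j x == i) e `^ alpha =
    \sum_(x <- [fset x in F | j x == i]%fset) e `^ alpha.
  by rewrite big_fset_condE.
rewrite sum_fset_const mulrC -mulrA -powRM//.
apply: (@packing _ (v i)) => //.
- by rewrite mulr_ge0.
- by move=> x y; rewrite !inE/= => /andP[xF _] /andP[yF _]; exact: sepF.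
- by move=> x; rewrite !inE/= => /andP[xF /eqP <-]; apply: (jP _ xF).2.
Qed.

End packing.

Section hausdorff.
Set Implicit Arguments.
Unset Strict Implicit.
Context {R : realType} {X : pmetricType R}.
Implicit Types (A B V : set X) (s e : R).
Local Open Scope ereal_scope.

Lemma diam_ge0 V : 0 <= diam V.
Proof. by apply: ereal_sup_ubound; left. Qed.

Lemma le_diam V (a b : X) : V a -> V b -> (mdist a b)%:E <= diam V.
Proof. by move=> Va Vb; apply: ereal_sup_ubound; right; exists (a, b). Qed.

Lemma diam_le V e : (0 <= e)%R ->
  (forall a b : X, V a -> V b -> (mdist a b <= e)%R) -> diam V <= e%:E.
Proof.
move=> e0 h; apply: ge_ereal_sup => _ [->|[[a b] [Va Vb] <-]].
  by rewrite lee_fin.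
by rewrite lee_fin; exact: h.
Qed.

Lemma diam_pow_ge0 s V : 0 <= diam_pow s V.
Proof. by rewrite /diam_pow; case: ifPn => // _; exact: poweR_ge0. Qed.

Lemma hausdorff_content_ge0 s e A : 0 <= hausdorff_content s e A.
Proof.
apply: le_ereal_inf_tmp => _ [V _ <-].
by apply: nneseries_ge0 => n _ _; exact: diam_pow_ge0.
Qed.

Lemma hausdorff_measure_ge0 s A : 0 <= hausdorff_measure s A.
Proof.
apply: (le_trans (hausdorff_content_ge0 s 1 A)).
by apply: ereal_sup_ubound; exists 1%R => //=; exact: ltr01.
Qed.

Lemma hausdorff_measure_eq0 s A :
  (forall e, (0 < e)%R -> hausdorff_content s e A <= 0) ->
  hausdorff_measure s A = 0.
Proof.
move=> h; apply/eqP; rewrite eq_le hausdorff_measure_ge0 andbT.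
by apply: ge_ereal_sup => _ [e e0 <-]; exact: h.
Qed.

Lemma hausdorff_measure_neq0 s A e : (0 < e)%R ->
  (forall V : (set X)^nat, A `<=` \bigcup_i V i ->
    (forall i, diam (V i) <= 1%:E) ->
    e%:E <= \sum_(0 <= i <oo) diam_pow s (V i)) ->
  hausdorff_measure s A <> 0.
Proof.
move=> e0 h; apply/eqP; rewrite gt_eqF//.
apply: (@lt_le_trans _ _ e%:E); first by rewrite lte_fin.
apply: (@le_trans _ _ (hausdorff_content s 1 A)); last first.
  by apply: ereal_sup_ubound; exists 1%R => //=; exact: ltr01.
by apply: le_ereal_inf_tmp => _ [V [AV dV] <-]; exact: h.
Qed.

Lemma le_hausdorff_measure s A B : A `<=` B ->
  hausdorff_measure s A <= hausdorff_measure s B.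
Proof.
move=> AB; apply: ge_ereal_sup => _ [e e0 <-].
apply: (@le_trans _ _ (hausdorff_content s e B)); last first.
  by apply: ereal_sup_ubound; exists e.
apply: le_ereal_inf => _ [V [BV dV] <-]; exists V => //; split => //.
exact: subset_trans BV.
Qed.

Lemma le_hausdorff_dim A B : A `<=` B -> hausdorff_dim A <= hausdorff_dim B.
Proof.
move=> AB; apply: le_ereal_inf => _ [s [s0 sB] <-]; exists s => //; split => //.
apply/eqP; rewrite eq_le hausdorff_measure_ge0 andbT -sB.
exact: le_hausdorff_measure.
Qed.

Lemma hausdorff_dim_le A (L : \bar R) : 0 <= L ->
  (forall s, (0 < s)%R -> L < s%:E -> hausdorff_measure s A = 0) ->
  hausdorff_dim A <= L.
Proof.
move=> L0 h; apply/lee_addgt0Pr => e e0.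
case: L L0 h => [L| |]//= L0 h; last by rewrite leey.
rewrite lee_fin in L0.
apply: ereal_inf_lbound; exists (L + e)%R => //; split.
  by rewrite addr_ge0// ltW.
by apply: h; rewrite ?lte_fin ?ltrDl// ltr_wpDl.
Qed.

Lemma hausdorff_dim_ge A (L : \bar R) :
  (forall s, (0 <= s)%R -> s%:E < L -> hausdorff_measure s A <> 0) ->
  L <= hausdorff_dim A.
Proof.
move=> h; apply: le_ereal_inf_tmp => _ [s [s0 sA] <-].
by rewrite leNgt; apply/negP => /(h _ s0).
Qed.

Lemma hausdorff_measure0_neq0 A : A !=set0 -> hausdorff_measure 0 A <> 0.
Proof.
move=> [x Ax]; apply: (hausdorff_measure_neq0 (e := 1%R)) => // V AV _.
have [i _ Vx] := AV x Ax.
apply: (@le_trans _ _ (\sum_(0 <= j < i.+1) diam_pow 0 (V j))); last first.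
  by apply: nneseries_lim_ge => n _ _; exact: diam_pow_ge0.
rewrite big_nat_recr//= -[leLHS]add0e; apply: leeD.
  by apply: sume_ge0 => j _; exact: diam_pow_ge0.
rewrite /diam_pow; case: ifPn => [/eqP V0|_]; last by rewrite poweRe0.
by move: Vx; rewrite V0.
Qed.

(* Enlarging the diameter of the [i]-th set so that its [s]-th power grows by
   [c / 4 / 2 ^ i] makes all the [d i] positive. *)
Lemma hausdorff_measure_neq0_escape s c A : (0 < s)%R -> (0 < c)%R ->
  (forall (V : nat -> set X) (d : nat -> R), (forall i, (0 < d i)%R) ->
    (forall i (a b : X), V i a -> V i b -> (mdist a b <= d i)%R) ->
    sums_le [set: nat] (fun i => (d i `^ s)%R) c ->
    exists2 x, A x & forall i, ~ V i x) ->
  hausdorff_measure s A <> 0.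
Proof.
move=> s0 c0 h; apply: (hausdorff_measure_neq0 (e := (c / 2)%R)).
  by rewrite divr_gt0.
move=> V AV dV; rewrite leNgt; apply/negP => sumV.
pose e i := fine (diam (V i)).
have eE i : diam (V i) = (e i)%:E.
  rewrite fineK// ge0_fin_numE ?diam_ge0//.
  by apply: le_lt_trans (dV i) _; rewrite ltry.
have e0 i : (0 <= e i)%R by rewrite -lee_fin -eE diam_ge0.
pose g i := (if V i == set0 then 0 else e i `^ s)%R.
have g0 i : (0 <= g i)%R by rewrite /g; case: ifPn => // _; exact: powR_ge0.
have gE i : diam_pow s (V i) = (g i)%:E.
  by rewrite /diam_pow /g; case: ifPn => // _; rewrite eE.
have sumg : sums_le [set: nat] g (c / 2).
  apply/(sums_le_nneseries _ g0).
  by under eq_eseriesr do rewrite -gE; exact: ltW.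
pose w i := (g i + c / 4 * 2^-1 ^+ i)%R.
have w0 i : (0 < w i)%R.
  by rewrite ltr_wpDl// mulr_gt0 ?divr_gt0// exprn_gt0// invr_gt0.
have [|||x Ax] := h V (fun i => w i `^ s^-1)%R.
- by move=> i; rewrite powR_gt0.
- move=> i a b Va Vb; have : (mdist a b <= e i)%R by rewrite -lee_fin -eE le_diam.
  move/le_trans; apply.
  have -> : e i = ((e i `^ s) `^ s^-1)%R by rewrite -powRrM divff ?gt_eqF// powRr1.
  rewrite ge0_ler_powR ?nnegrE ?powR_ge0 ?invr_ge0 ?(ltW s0) ?(ltW (w0 i))//.
  have Vn : V i != set0 by apply/set0P; exists a.
  rewrite /w /g (negbTE Vn) lerDl; apply: mulr_ge0.
    by rewrite divr_ge0// ltW.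
  by rewrite exprn_ge0// invr_ge0.
- have h2 : sums_le [set: nat] (fun i => c / 4 * 2^-1 ^+ i)%R (c / 2)%R.
    have -> : (c / 2 = c / 4 * (1 - 2^-1)^-1)%R by field.
    apply: (sums_leM (g := fun i => 2^-1 ^+ i)%R) => //.
      by rewrite divr_ge0// ltW.
    by apply: sums_le_geometric; lra.
  move=> F FT; under eq_bigr do rewrite -powRrM mulVf ?gt_eqF// powRr1 ?ltW//.
  by rewrite big_split/=; have := sumg F FT; have := h2 F FT; lra.
- by have [i _ Vx] := AV x Ax; move=> /(_ i).
Qed.

Lemma hausdorff_content_le s e b A (K : set X) (r : X -> R) :
  (0 < s)%R -> (0 <= e)%R -> (0 <= b)%R -> countable K ->
  (forall x, K x -> (0 <= r x)%R /\ (2 * r x <= e)%R) ->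
  A `<=` \bigcup_(x in K) ball x (r x) ->
  sums_le K (fun x => (2 * r x) `^ s)%R b ->
  hausdorff_content s e A <= b%:E.
Proof.
move=> s0 e0 b0 /countable_injP[f finj] rK AK sumK.
pose N := f @` K.
have [g gP] : {g : nat -> X & forall n, N n -> K (g n) /\ f (g n) = n}.
  apply: (choice (P := fun n x => N n -> K x /\ f x = n)) => n.
  have [[x Kx fx]|nN] := pselect (N n); first by exists x.
  by exists point.
pose V n := if `[< N n >] then ball (g n) (r (g n)) else set0.
pose h n := if `[< N n >] then ((2 * r (g n)) `^ s)%R else 0%R.
have h0 n : (0 <= h n)%R by rewrite /h; case: asboolP => // _; exact: powR_ge0.
have dV n : diam (V n) <= (if `[< N n >] then 2 * r (g n) else 0)%:E.
  rewrite /V; case: asboolP => [/gP[/rK[r0 _] _]|_]; last first.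
    by apply: diam_le => // a a' [].
  apply: diam_le; first by rewrite mulr_ge0.
  move=> a a'; rewrite !ballEmdist/= => ga ga'.
  have := metric_triangle a (g n) a'; rewrite (metric_sym a (g n)); lra.
have hsum : sums_le [set: nat] h b.
  apply: (sums_le_support (A := N)) => //.
    by move=> n Nn; rewrite /h; case: asboolP.
  have hr : sums_le N (fun n => (2 * r (g n)) `^ s)%R b.
    apply: (sums_le_reindex (A := K) (f := fun x => (2 * r x) `^ s)%R) => //.
      by move=> n /gP[].
    by move=> m n /gP[_ {2}<-] /gP[_ {2}<-] ->.
  rewrite -[b]mul1r; apply: (sums_leM _ _ hr) => // n Nn.
  by rewrite /h mul1r; case: asboolP.
apply: (@le_trans _ _ (\sum_(0 <= i <oo) diam_pow s (V i))); last first.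
  apply: (@le_trans _ _ (\sum_(0 <= i <oo) (h i)%:E)); last exact/sums_le_nneseries.
  apply: lee_nneseries => [n _ _|n _]; first exact: diam_pow_ge0.
  rewrite /diam_pow; case: ifPn => [_|]; first by rewrite lee_fin.
  have := dV n; rewrite /V /h; case: asboolP => [Nn dn _|_ _]; last by rewrite eqxx.
  rewrite -poweR_EFin; apply: gt0_ler_poweR; rewrite ?(ltW s0) ?in_itv/= ?leey ?andbT//.
  - exact: diam_ge0.
  - by have [/rK[r0 _] _] := gP _ Nn; rewrite lee_fin mulr_ge0.
apply: ereal_inf_lbound; exists V => //; split.
  move=> x /AK[y Ky yx]; have Nf : N (f y) by exists y.
  exists (f y) => //; rewrite /V asboolT//; have [Kg fg] := gP _ Nf.
  by rewrite (finj _ _ _ _ fg) ?inE.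
move=> n; apply: le_trans (dV n) _; rewrite lee_fin; case: asboolP => // /gP[/rK[]//].
Qed.

Lemma hausdorff_measure_set0 s : (0 < s)%R -> hausdorff_measure s (@set0 X) = 0.
Proof.
move=> s0; apply: hausdorff_measure_eq0 => e e0.
apply: (hausdorff_content_le (K := set0) (r := fun=> 0%R)) => //.
- exact: ltW.
- by move=> F F0; rewrite big_seq big1// => x /F0.
Qed.

End hausdorff.

Section order_at_zero.
Set Implicit Arguments.
Unset Strict Implicit.
Context {R : realType} (psi : R -> R).
Context (psi_gt0 : forall t : R, 0 < t -> 0 < psi t).

Let ratio x := (ln (psi x) / ln x)%:E.

Lemma ln_ratio_lt l x : 0 < x -> x < 1 ->
  (l < ln (psi x) / ln x) = (psi x < x `^ l).
Proof.
move=> x0 x1; have lx : ln x < 0 by rewrite ln_lt0// x0.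
rewrite ltr_ndivlMr// -ln_powR ltr_ln ?posrE ?powR_gt0//.
exact: psi_gt0.
Qed.

Lemma ln_ratio_gt l x : 0 < x -> x < 1 ->
  (ln (psi x) / ln x < l) = (x `^ l < psi x).
Proof.
move=> x0 x1; have lx : ln x < 0 by rewrite ln_lt0// x0.
rewrite ltr_ndivrMr// -ln_powR ltr_ln ?posrE ?powR_gt0//.
exact: psi_gt0.
Qed.

Lemma at_right0P (V : set R) :
  (0 : R)^'+ V <-> exists2 t, 0 < t & forall x, 0 < x -> x < t -> V x.
Proof.
split=> [/nbhs_ballP[t /= t0 h]|[t t0 h]].
  exists t => // x x0 xt; apply: h => //.
  by rewrite /ball/= sub0r normrN gtr0_norm.
apply/nbhs_ballP; exists t => //= x + x0.
by rewrite /ball/= sub0r normrN gtr0_norm// => xt; exact: h.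
Qed.

Lemma lt_lower_order l : (l%:E < lower_order psi)%E ->
  exists2 t, 0 < t & forall x, 0 < x -> x < t -> psi x <= x `^ l.
Proof.
rewrite /lower_order limf_einfE => /ereal_sup_gt[_ [V /at_right0P[t t0 hV] <-]] lV.
exists (Num.min t 1) => [|x x0]; first by rewrite lt_min t0/=.
rewrite lt_min => /andP[xt x1]; apply/ltW; rewrite -ln_ratio_lt// -lte_fin.
by apply: lt_le_trans lV _; apply: ereal_inf_lbound; exists x => //; exact: hV.
Qed.

Lemma lower_order_lt l t : (lower_order psi < l%:E)%E -> 0 < t ->
  exists x, [/\ 0 < x, x < t & x `^ l <= psi x].
Proof.
rewrite /lower_order limf_einfE => ltl t0.
pose V := [set x : R | 0 < x /\ x < Num.min t 1].
have V0 : (0 : R)^'+ V.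
  by apply/at_right0P; exists (Num.min t 1) => //; rewrite lt_min t0/=.
have : (ereal_inf (ratio @` V) < l%:E)%E.
  by apply: le_lt_trans ltl; apply: ereal_sup_ubound; exists V.
move=> /ereal_inf_lt[_ [x [x0 +] <-]].
rewrite lt_min => /andP[xt x1]; rewrite lte_fin ln_ratio_gt// => h.
by exists x; split => //; exact: ltW.
Qed.

Lemma lower_order_ge1 : (exists2 t, 0 < t & forall x, 0 < x -> x < t -> psi x <= x) ->
  (1%:E <= lower_order psi)%E.
Proof.
move=> [t t0 h]; rewrite /lower_order limf_einfE.
pose V := [set x : R | 0 < x /\ x < Num.min t 1].
have V0 : (0 : R)^'+ V.
  by apply/at_right0P; exists (Num.min t 1) => //; rewrite lt_min t0/=.
apply: (@le_trans _ _ (ereal_inf (ratio @` V))); last first.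
  by apply: ereal_sup_ubound; exists V.
apply: le_ereal_inf_tmp => _ [x [x0 +] <-].
rewrite lt_min => /andP[xt x1]; rewrite lee_fin leNgt ln_ratio_gt//.
by rewrite powRr1 ?(ltW x0)// -leNgt h.
Qed.

End order_at_zero.

Section constants.
Set Implicit Arguments.
Unset Strict Implicit.
Context {R : realType} {X : pmetricType R}.
Context (mu : {measure set (borel X) -> \bar R}).
Implicit Types (alpha beta C D : R) (Q : set X) (rad : X -> R).

Lemma well_separated_le Q rad C C' : 0 < C -> C <= C' ->
  (forall xi, Q xi -> 0 < rad xi) ->
  well_separated Q rad C -> well_separated Q rad C'.
Proof.
move=> C0 CC rad0 h xi zeta Qx Qz xz; apply: le_trans (h _ _ Qx Qz xz).
rewrite ler_wpM2r//; first by rewrite le_min !ltW// rad0.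
by rewrite lef_pV2 ?posrE// (lt_le_trans C0).
Qed.

Lemma well_distributed_le alpha Q rad C C' : 0 < C -> C <= C' ->
  well_distributed mu alpha Q rad C -> well_distributed mu alpha Q rad C'.
Proof.
move=> C0 CC h eta r r0; have C'0 := lt_le_trans C0 CC.
have [k0 k00 hk] := h eta r r0; exists k0 => // k kk.
have k1 : 0 < k%:R :> R by rewrite ltr0n (leq_trans k00).
have [QB [h1 h2 h3 h4]] := hk k kk; exists QB; split => //.
  move=> xi /h2/andP[h5 h6]; apply/andP; split.
    apply: le_trans h5; rewrite lef_pV2 ?posrE ?mulr_gt0//.
    by rewrite ler_pM2r.
  by apply: le_trans h6 _; rewrite ler_pM2r// invr_gt0.
apply: le_trans h4; rewrite lee_wpmul2r// lee_fin ler_wpM2r ?powR_ge0//.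
by rewrite lef_pV2 ?posrE.
Qed.

Lemma ahlfors_ball_le alpha C C' D : 0 < C -> C <= C' ->
  (D%:E <= diam [set: X])%E -> ahlfors_bounds mu alpha C ->
  forall (xi : X) (r : R), 0 <= r -> r <= D ->
  ((r `^ alpha / C')%:E <= mu (ball xi r))%E /\
  (mu (ball xi r) <= (C' * r `^ alpha)%:E)%E.
Proof.
move=> C0 CC DX h xi r r0 rD.
have [|h1 h2] := h xi r r0; first by apply: le_trans DX; rewrite lee_fin.
split.
  apply: le_trans h1; rewrite lee_fin ler_wpM2l ?powR_ge0//.
  by rewrite lef_pV2 ?posrE// (lt_le_trans C0).
by apply: le_trans h2 _; rewrite lee_fin ler_wpM2r ?powR_ge0.
Qed.

Lemma annulus_neq0 alpha beta C D : 0 < C -> (D%:E <= diam [set: X])%E ->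
  annular_bounds mu alpha beta C ->
  forall (xi : X) (a b : R), 0 < a -> a < b -> b <= D ->
    exists y, a <= mdist xi y /\ mdist xi y <= b.
Proof.
move=> C0 DX h xi a b a0 ab bD.
have [|] := pselect (annulus xi a b !=set0).
  move=> [y []]; rewrite ballEmdist/= => h1 h2; exists y; split => //.
  by rewrite leNgt; apply/negP.
move/set0P/negP; rewrite negbK => /eqP A0.
have bX : (b%:E <= diam [set: X])%E by apply: le_trans DX; rewrite lee_fin.
have := h xi a b (ltW a0) (ltW ab) bX; rewrite A0 measure0 lee_fin leNgt.
move=> /negP h0; exfalso; apply: h0.
by rewrite !mulr_gt0 ?invr_gt0 ?powR_gt0// divr_gt0// subr_gt0.
Qed.

(* On a one-point space the point would carry all the mass, whereas the sets
   [QB] have at least [k ^ alpha / C] times that mass for all large [k]. *)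
Lemma exists_mdist_gt0 alpha C Q rad : 0 < alpha -> 0 < C ->
  mu [set: X] <> 0%E -> well_distributed mu alpha Q rad C ->
  exists x y : X, 0 < mdist x y.
Proof.
move=> alpha0 C0 mu0 wd; apply: contrapT => noxy.
have all_eq (x y : X) : x = y.
  apply: contrapT => xy; apply: noxy; exists x, y.
  by rewrite mdist_gt0; apply/eqP.
have ballT : ball (point : X) (1 : R) = [set: X].
  by rewrite -subTset => y _; rewrite (all_eq y point); exact: ballxx.
have [k0 k00 hk] := wd point 1 ltr01.
have cardQB (QB : set X) : (counting QB <= (1 : R)%:E)%E.
  have finQB : finite_set QB.
    by apply: (@sub_finite_set _ _ [set point]) => // y _; exact: all_eq.
  rewrite /counting asboolT// lee_fin -[leRHS]/(1%:R) ler_nat.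
  rewrite -(cardfs1 (point : X)); apply: fsubset_leq_card.
  by apply/fsubsetP => y _; rewrite inE; apply/eqP; exact: all_eq.
have muT : (0 < mu [set: X])%E by rewrite measure_gt0; exact/eqP.
have key k : (k0 <= k)%N -> ((C^-1 * k%:R `^ alpha)%:E * mu [set: X] <= 1%:E)%E.
  move=> kk; have [QB [_ _ _ h]] := hk k kk.
  by rewrite -ballT; apply: le_trans h (cardQB _).
have kpos k : (k0 <= k)%N -> 0 < C^-1 * k%:R `^ alpha.
  by move=> kk; rewrite mulr_gt0 ?invr_gt0// powR_gt0// ltr0n (leq_trans k00).
have [m mE] : exists m : R, mu [set: X] = m%:E.
  exists (fine (mu [set: X])); rewrite fineK// ge0_fin_numE//.
  have := key k0 (leqnn _); have := kpos _ (leqnn k0).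
  case: (mu [set: X]) muT => [m _|_|]//; first by rewrite ltry.
  by move=> c0; rewrite gt0_muley// lte_fin.
have m0 : 0 < m by rewrite -lte_fin -mE.
have Cm0 : 0 < C / m by rewrite divr_gt0.
pose k := (maxn k0 (Num.truncn ((C / m) `^ alpha^-1)).+1).
have := key k (leq_maxl _ _); rewrite mE -EFinM lee_fin.
apply/negP; rewrite -ltNge -mulrA mulrC ltr_pdivlMr// mul1r -ltr_pdivrMr//.
have -> : C / m = ((C / m) `^ alpha^-1) `^ alpha.
  by rewrite -powRrM mulVf ?gt_eqF// powRr1// ltW.
rewrite gt0_ltr_powR ?nnegrE ?powR_ge0//.
by apply: (lt_le_trans (truncnS_gt _)); rewrite ler_nat leq_maxr.
Qed.

End constants.

Record stage (R X : Type) := Stage {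
  center : X; radius : R; threshold : R; target : X }.
Arguments Stage {R X}.
Arguments center {R X}.
Arguments radius {R X}.
Arguments threshold {R X}.
Arguments target {R X}.

Section well_distributed_sets.
Set Implicit Arguments.
Unset Strict Implicit.
Context {R : realType} {X : pmetricType R}.
Context (mu : {measure set (borel X) -> \bar R}) (alpha C D M S : R).
Context (Q : set X) (rad : X -> R) (psi : R -> R).
Context (alpha_gt0 : 0 < alpha) (C_ge1 : 1 <= C) (D_gt0 : 0 < D).
Context (ahl : forall (xi : X) (r : R), 0 <= r -> r <= D ->
  ((r `^ alpha / C)%:E <= mu (ball xi r))%E /\
  (mu (ball xi r) <= (C * r `^ alpha)%:E)%E).
Context (rad_gt0 : forall xi, Q xi -> 0 < rad xi).
Context (rad_le : forall xi, Q xi -> rad xi <= M).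
Context (sep : well_separated Q rad C).
Context (wd : well_distributed mu alpha Q rad C).
Context (psi_gt0 : forall t : R, 0 < t -> 0 < psi t).
Context (psi_mono : forall s t : R, 0 < s -> s <= t -> psi s <= psi t).
Context (series_le : sums_le Q (fun xi => (psi (rad xi) / rad xi) `^ alpha) S).

Let C_gt0 : 0 < C. Proof. exact: lt_le_trans C_ge1. Qed.

Lemma psi_rad_gt0 xi : Q xi -> 0 < psi (rad xi).
Proof. by move=> /rad_gt0/psi_gt0. Qed.

Lemma finite_large_rad t : 0 < t -> finite_set [set xi | Q xi /\ t <= rad xi].
Proof.
move=> t0; have [[x0 Qx0]|Q0] := pselect (exists x, Q x); last first.
  have -> : [set xi | Q xi /\ t <= rad xi] = set0.
    by rewrite -subset0 => x [Qx _]; case: Q0; exists x.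
  exact: finite_set0.
have M0 : 0 < M by apply: lt_le_trans (rad_gt0 Qx0) (rad_le Qx0).
apply: (@sums_le_finite R X _ (fun xi => (psi (rad xi) / rad xi) `^ alpha) S
    ((psi t / M) `^ alpha)).
- by rewrite powR_gt0// divr_gt0// psi_gt0.
- move=> xi [Qxi txi]; have r0 := rad_gt0 Qxi.
  rewrite ge0_ler_powR ?nnegrE ?divr_ge0 ?(ltW alpha_gt0) ?(ltW M0) ?(ltW r0)//;
    rewrite ?(ltW (psi_gt0 _))//.
  apply: ler_pM; rewrite ?invr_ge0 ?(ltW M0) ?(ltW (psi_gt0 _))//.
    exact: psi_mono.
  by rewrite lef_pV2 ?posrE// rad_le.
- by apply: sums_leS series_le => // x [].
Qed.

Lemma series_tail e : 0 < e -> exists2 t, 0 < t &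
  sums_le [set xi | Q xi /\ rad xi <= t]
    (fun xi => (psi (rad xi) / rad xi) `^ alpha) e.
Proof.
by apply: sums_le_tail series_le _ => // xi _; exact: powR_ge0.
Qed.

Lemma psi_rad_le e : 0 < e -> exists2 t, 0 < t &
  forall xi, Q xi -> rad xi <= t -> psi (rad xi) <= e * rad xi.
Proof.
move=> e0; have [t t0 ht] := series_tail (powR_gt0 alpha e0).
exists t => // xi Qxi xit; have r0 := rad_gt0 Qxi.
have := sums_le_term ht (conj Qxi xit); rewrite -ler_pdivrMr//.
apply: contraTT; rewrite -!ltNge => h.
by rewrite gt0_ltr_powR// nnegrE ?divr_ge0 ?ltW// psi_gt0.
Qed.

Lemma sep_ge x0 xi zeta : 0 < x0 -> Q xi -> Q zeta -> xi <> zeta ->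
  x0 <= rad xi -> x0 <= rad zeta -> x0 / C <= mdist xi zeta.
Proof.
move=> x00 Qxi Qz xz xi0 z0; apply: le_trans (sep Qxi Qz xz).
by rewrite mulrC ler_wpM2l ?invr_ge0 ?(ltW C_gt0)// le_min xi0.
Qed.

(* [x0] stands for [1 / (C * k)] in the definition of well-distributedness. *)
Lemma candidates y r : 0 < r -> r <= D -> exists2 t, 0 < t &
  forall x0, 0 < x0 -> x0 < t -> exists F : {fset X},
    (forall xi, xi \in F -> [/\ Q xi, x0 <= rad xi, rad xi <= 2 * C ^+ 2 * x0
      & ball xi (rad xi) `<=` ball y (r / 4)]) /\
    (r / (8 * C * x0)) `^ alpha / C ^+ 2 <= #|` F|%:R.
Proof.
move=> r0 rD; have r40 : 0 < r / 4 by lra.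
have [kB kB0 hk] := wd y r40.
exists (C * kB.+1%:R)^-1; first by rewrite invr_gt0 mulr_gt0.
move=> x0 x00 xt; pose k := Num.truncn (C * x0)^-1.
have Cx0 : 0 < C * x0 by rewrite mulr_gt0.
have kBle : (kB < k)%N.
  rewrite /k truncn_ge_nat ?invr_ge0 ?(ltW Cx0)//.
  rewrite -(ler_pM2r Cx0) mulVf ?gt_eqF//.
  by move: xt; rewrite -[ltRHS]mul1r ltr_pdivlMr ?mulr_gt0// => h; lra.
have k0 : 0 < k%:R :> R by rewrite ltr0n (leq_trans _ kBle).
have k_le : k%:R <= (C * x0)^-1 by rewrite /k truncn_le ?invr_ge0 ?ltW.
have k_ge : (C * x0)^-1 <= 2 * k%:R.
  have : (C * x0)^-1 < k.+1%:R by exact: truncnS_gt.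
  have : 1 <= k%:R :> R by rewrite ler1n (leq_trans _ kBle).
  rewrite -natr1; lra.
have [QB [QBQ QBrad QBball QBcard]] := hk k (ltnW kBle).
have QBrad' xi : QB xi -> x0 <= rad xi /\ rad xi <= 2 * C ^+ 2 * x0.
  move=> /QBrad/andP[h1 h2]; split.
    apply: le_trans h1; rewrite -[leLHS]invrK lef_pV2 ?posrE ?invr_gt0 ?mulr_gt0//.
    by rewrite mulrC -ler_pdivlMr// -invfM mulrC.
  apply: le_trans h2 _; rewrite ler_pdivrMr//.
  have : 1 <= 2 * k%:R * (C * x0) by rewrite -ler_pdivrMr// mul1r.
  rewrite -(ler_pM2l C_gt0) => h; lra.
have finQB : finite_set QB.
  apply: sub_finite_set (finite_large_rad x00) => xi QBxi.
  by split; [exact: QBQ|case: (QBrad' _ QBxi)].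
exists (fset_set QB); split.
  move=> xi; rewrite in_fset_set// inE => QBxi.
  have [h1 h2] := QBrad' _ QBxi; split => //; first exact: QBQ.
  by move=> z xiz; apply: QBball; exists xi.
rewrite -lee_fin; move: QBcard; rewrite /counting asboolT//; apply: le_trans.
have r4D : r / 4 <= D by lra.
have [+ _] := ahl y (ltW r40) r4D => h.
apply: (@le_trans _ _ ((C^-1 * k%:R `^ alpha * ((r / 4) `^ alpha / C))%:E));
  last first.
  by rewrite EFinM lee_wpmul2l// lee_fin mulr_ge0 ?powR_ge0 ?invr_ge0 ?ltW.
rewrite lee_fin; have -> : C^-1 * k%:R `^ alpha * ((r / 4) `^ alpha / C) =
    k%:R `^ alpha * (r / 4) `^ alpha / C ^+ 2 by field; rewrite gt_eqF.
rewrite ler_wpM2r ?invr_ge0 ?sqr_ge0//.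
rewrite -powRM ?(ltW r40)// ge0_ler_powR ?nnegrE ?(ltW alpha_gt0)//.
- by rewrite ltW// divr_gt0// mulr_gt0// mulr_gt0.
- by rewrite mulr_ge0 ?ltW.
have -> : r / (8 * C * x0) = (C * x0)^-1 / 2 * (r / 4).
  by field; rewrite !gt_eqF.
by rewrite ler_wpM2r ?(ltW r40)//; lra.
Qed.

Lemma candidate y r : 0 < r -> r <= D -> exists2 t, 0 < t &
  forall x0, 0 < x0 -> x0 < t -> exists xi, [/\ Q xi, x0 <= rad xi,
    rad xi <= 2 * C ^+ 2 * x0 & ball xi (rad xi) `<=` ball y (r / 4)].
Proof.
move=> r0 rD; have [t t0 h] := candidates y r0 rD.
exists t => // x0 x00 x0t; have [F [FQ cF]] := h x0 x00 x0t.
have F0 : F != fset0.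
  apply/eqP => F0; move: cF; rewrite F0 cardfs0; apply/negP; rewrite -ltNge.
  by rewrite divr_gt0 ?exprn_gt0// powR_gt0// divr_gt0// !mulr_gt0.
by have [xi /FQ] := fset0Pn _ F0; exists xi.
Qed.

Lemma psi_le_id : exists2 t, 0 < t & forall x, 0 < x -> x < t -> psi x <= x.
Proof.
have C20 : 0 < 2 * C ^+ 2 by rewrite mulr_gt0 ?exprn_gt0.
have e0 : 0 < (2 * C ^+ 2)^-1 by rewrite invr_gt0.
have [t1 t10 h1] := psi_rad_le e0.
have [t2 t20 h2] := candidate point D_gt0 (lexx _).
exists (Num.min t2 (t1 / (2 * C ^+ 2))); first by rewrite lt_min t20 divr_gt0.
move=> x x0; rewrite lt_min => /andP[xt2 xt1].
have [xi [Qxi h3 h4 _]] := h2 x x0 xt2.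
apply: le_trans (psi_mono x0 h3) _; apply: le_trans (h1 _ Qxi _) _.
  by apply: le_trans h4 _; rewrite mulrC -ler_pdivlMr// ltW.
by rewrite mulrC ler_pdivrMr// mulrC.
Qed.

Section cantor_construction.
Context (U : nat -> set X) (d : nat -> R) (s l : R).
Context (s_gt0 : 0 < s) (s_le : s <= alpha) (sl_lt : s * l < alpha).
Context (d_gt0 : forall i, 0 < d i).
Context (d_diam : forall i (a b : X), U i a -> U i b -> mdist a b <= d i).
Context (psi_ge : forall t : R, 0 < t ->
  exists x : R, [/\ 0 < x, x < t & x `^ l <= psi x]).
Context (ann : forall (xi : X) (a b : R), 0 < a -> a < b -> b <= D ->
  exists y, a <= mdist xi y /\ mdist xi y <= b).

(* This value makes the bound of [few_hit] a quarter of the number of points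
   provided by [candidates]. *)
Definition kappa : R := (4 * C ^+ 4 * (64 * C ^+ 2) `^ alpha)^-1.

Lemma kappa_gt0 : 0 < kappa.
Proof.
by rewrite invr_gt0 !mulr_gt0 ?exprn_gt0// powR_gt0// mulr_gt0 ?exprn_gt0.
Qed.

Lemma kappa_le1 : kappa <= 1.
Proof.
rewrite invf_le1 ?mulr_gt0 ?exprn_gt0 ?powR_gt0 ?mulr_gt0 ?exprn_gt0//.
have C4 : 1 <= C ^+ 4 by rewrite exprn_ege1.
have C2 : 1 <= C ^+ 2 by rewrite exprn_ege1.
have : 1 <= (64 * C ^+ 2) `^ alpha.
  by rewrite -[leLHS](powRr0 (64 * C ^+ 2)) ler_powR ?(ltW alpha_gt0)//; lra.
by move=> h; rewrite -[leLHS]mulr1 ler_pM//; lra.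
Qed.

Definition hits y r : set nat := [set i | U i `&` ball y r !=set0].

(* [light] and [sparse] are the two bounds with constant kappa described in the
   header. *)
Definition light y r : Prop :=
  sums_le (hits y r) (fun i => d i `^ s) (kappa * r `^ s).

Definition sparse t r : Prop :=
  sums_le [set zeta | Q zeta /\ rad zeta <= t]
    (fun zeta => psi (rad zeta) `^ alpha) (kappa * r `^ alpha).

Lemma kappa_powR_le p r x : 0 < p -> 0 < r -> 0 <= x ->
  x `^ p <= kappa * r `^ p -> x <= r.
Proof.
move=> p0 r0 x0 h; rewrite leNgt; apply/negP => rx.
have : r `^ p < x `^ p by rewrite gt0_ltr_powR// nnegrE ltW.
apply/negP; rewrite -leNgt; apply: le_trans h _.
by rewrite ler_piMl ?powR_ge0 ?kappa_le1.
Qed.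

Lemma few_hit {T : choiceType} (I : set T) (v : T -> X) (f : T -> R) r x0
    (G : {fset X}) :
  0 < r -> r <= D / 4 -> 0 < x0 -> x0 <= D -> (forall i, I i -> 0 <= f i) ->
  sums_le I (fun i => f i `^ alpha) (kappa * r `^ alpha) ->
  (forall xi, xi \in G -> Q xi /\ x0 <= rad xi) ->
  (forall xi, xi \in G ->
    exists2 i, I i & ball xi (x0 / (2 * C)) `<=` ball (v i) (4 * f i)) ->
  #|` G|%:R <= (r / (8 * C * x0)) `^ alpha / C ^+ 2 / 4.
Proof.
move=> r0 rD x00 x0D f0 sumI GQ hitG.
have e0 : 0 < x0 / (2 * C) by rewrite divr_gt0 ?mulr_gt0.
have : #|` G|%:R * (x0 / (2 * C)) `^ alpha <=
    C ^+ 2 * 4 `^ alpha * (kappa * r `^ alpha).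
  apply: (packing_cover C_gt0 ahl e0 _ _ sumI _ hitG).
  - apply: le_trans x0D; rewrite ler_pdivrMr ?mulr_gt0// ler_peMr ?(ltW x00)//.
    by have := C_ge1; lra.
  - move=> i Ii; split; first exact: f0.
    have := kappa_powR_le alpha_gt0 r0 (f0 _ Ii) (sums_le_term sumI Ii).
    lra.
  - move=> x y xG yG xy; have [Qx rx] := GQ _ xG; have [Qy ry] := GQ _ yG.
    apply: le_trans (sep_ge x00 Qx Qy xy rx ry).
    by rewrite le_eqVlt; apply/orP; left; apply/eqP; field; rewrite gt_eqF.
rewrite -ler_pdivlMr ?powR_gt0//; move=> h; apply: le_trans h _.
have z0 : 0 <= r / (8 * C * x0) by rewrite divr_ge0 ?mulr_ge0 ?ltW.
have C20 : 0 <= 16 * C ^+ 2 by rewrite mulr_ge0 ?sqr_ge0.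
have rE : r = r / (8 * C * x0) * (16 * C ^+ 2) * (x0 / (2 * C)).
  by field; rewrite !gt_eqF.
have -> : r `^ alpha = (r / (8 * C * x0)) `^ alpha * (16 * C ^+ 2) `^ alpha *
    (x0 / (2 * C)) `^ alpha.
  by rewrite -!powRM ?(ltW e0) ?(mulr_ge0 z0)// -rE.
rewrite /kappa; have -> : 64 * C ^+ 2 = 4 * (16 * C ^+ 2) :> R by ring.
rewrite (powRM _ _ C20)// le_eqVlt; apply/orP; left; apply/eqP.
have ? := gt_eqF (powR_gt0 alpha e0).
have ? : (16 * C ^+ 2) `^ alpha != 0 by rewrite gt_eqF ?powR_gt0 ?mulr_gt0 ?exprn_gt0.
have ? : 4 `^ alpha != 0 :> R by rewrite gt_eqF ?powR_gt0.
field; apply/and4P; split => //; rewrite gt_eqF//; exact: powR_gt0.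
Qed.

Lemma few_hit_cover y r x0 (F : {fset X}) :
  0 < r -> r <= D / 4 -> 0 < x0 -> x0 <= D -> light y r ->
  (forall xi, xi \in F -> [/\ Q xi, x0 <= rad xi & exists i,
    [/\ hits y r i, x0 / (2 * C) <= d i & exists2 u, U i u &
        mdist xi u <= x0 / (4 * C)]]) ->
  #|` F|%:R <= (r / (8 * C * x0)) `^ alpha / C ^+ 2 / 4.
Proof.
move=> r0 rD x00 x0D lyr hF.
have [v vU] : {v : nat -> X & forall i, hits y r i -> U i (v i)}.
  apply: (choice (P := fun i v => hits y r i -> U i v)) => i.
  have [[v [Uv _]]|h] := pselect (hits y r i).
    by exists v.
  by exists point.
have dr i : hits y r i -> d i <= r.
  move=> hi; apply: (kappa_powR_le s_gt0) => //; first exact: ltW.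
  exact: (sums_le_term lyr hi).
apply: (few_hit (I := hits y r) (v := v) (f := d)) => //.
- by move=> i _; exact: ltW.
- have -> : kappa * r `^ alpha = r `^ (alpha - s) * (kappa * r `^ s).
    rewrite mulrCA -powRD ?subrK//.
    by apply/implyP => _; rewrite gt_eqF.
  apply: sums_leM lyr; first exact: powR_ge0.
  move=> i hi; have -> : d i `^ alpha = d i `^ (alpha - s) * d i `^ s.
    rewrite -powRD ?subrK//.
    by apply/implyP => _; rewrite gt_eqF.
  rewrite ler_wpM2r ?powR_ge0// ge0_ler_powR ?nnegrE ?subr_ge0 ?(ltW r0)//.
    exact: ltW.
  exact: dr.
- by move=> xi /hF[].
- move=> xi /hF[Qxi rxi [i [hi di [u Uu xu]]]]; exists i => // z.
  rewrite !ballEmdist/= => xz.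
  have uv := d_diam (vU _ hi) Uu.
  have h1 := metric_triangle (v i) u z; have h2 := metric_triangle u xi z.
  rewrite (metric_sym u xi) in h2.
  have : x0 / (4 * C) = x0 / (2 * C) / 2 by field; rewrite gt_eqF.
  have : 0 < x0 / (2 * C) by rewrite divr_gt0 ?mulr_gt0.
  lra.
Qed.

Lemma few_hit_series r t x0 (F : {fset X}) :
  0 < r -> r <= D / 4 -> 0 < x0 -> x0 <= D -> sparse t r ->
  (forall xi, xi \in F -> [/\ Q xi, x0 <= rad xi & exists zeta,
    [/\ Q zeta /\ rad zeta <= t, x0 / (2 * C) <= psi (rad zeta) &
        mdist xi zeta <= x0 / (4 * C) + psi (rad zeta)]]) ->
  #|` F|%:R <= (r / (8 * C * x0)) `^ alpha / C ^+ 2 / 4.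
Proof.
move=> r0 rD x00 x0D spr hF.
apply: (few_hit (I := [set zeta | Q zeta /\ rad zeta <= t]) (v := idfun)
  (f := fun zeta => psi (rad zeta))) => //.
- by move=> zeta [/psi_rad_gt0/ltW].
- by move=> xi /hF[].
- move=> xi /hF[Qxi rxi [zeta [hz pz xz]]]; exists zeta => // z.
  rewrite !ballEmdist/= => xz'.
  have h2 := metric_triangle zeta xi z.
  rewrite (metric_sym zeta xi) in h2.
  have : x0 / (4 * C) = x0 / (2 * C) / 2 by field; rewrite gt_eqF.
  have : 0 < x0 / (2 * C) by rewrite divr_gt0 ?mulr_gt0.
  lra.
Qed.

(* Each [U i] with [d i < x0 / (2 * C)] meets at most one of the balls around the
   points of [F], so the masses of these balls add up to at most [kappa * r ^ s]. *)
Lemma light_child y r x0 q (F : {fset X}) (rho : X -> R) :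
  0 < r -> 0 < x0 -> 0 < q -> light y r ->
  x0 `^ (alpha - s * l) <= r `^ (alpha - s) / (4 * C ^+ 2 * (8 * C) `^ alpha * q `^ s) ->
  (r / (8 * C * x0)) `^ alpha / C ^+ 2 / 2 <= #|` F|%:R ->
  (forall xi, xi \in F -> [/\ Q xi, x0 <= rad xi, rho xi <= x0 / (4 * C),
    x0 `^ l <= rho xi & ball xi (rho xi) `<=` ball y r]) ->
  (forall xi i, xi \in F -> hits xi (rho xi) i -> d i < x0 / (2 * C)) ->
  exists2 xi, xi \in F & sums_le (hits xi (rho xi)) (fun i => d i `^ s)
    (kappa * (rho xi / q) `^ s).
Proof.
move=> r0 x00 q0 lyr x0le cF FQ smallF; apply: contrapT => noxi.
pose th := kappa * (x0 `^ l / q) `^ s.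
have [J hJ] : {J : X -> {fset nat} & forall xi, xi \in F ->
    (forall i, i \in J xi -> hits xi (rho xi) i) /\
    th < \sum_(i <- J xi) d i `^ s}.
  apply: (choice (P := fun xi (K : {fset nat}) => xi \in F ->
      (forall i, i \in K -> hits xi (rho xi) i) /\
      th < \sum_(i <- K) d i `^ s)) => xi.
  have [xiF|_] := boolP (xi \in F); last by exists fset0.
  apply: contrapT => noJ; apply: noxi; exists xi => // J hJ.
  have [_ _ _ rx _] := FQ _ xiF.
  apply: (@le_trans _ _ th).
    by rewrite leNgt; apply/negP => ?; apply: noJ; exists J.
  rewrite ler_wpM2l ?(ltW kappa_gt0)// ge0_ler_powR ?nnegrE ?(ltW s_gt0)//.
  - by rewrite divr_ge0 ?powR_ge0// ltW.
  - by rewrite divr_ge0 ?(ltW q0)// (le_trans _ rx)// powR_ge0.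
  - by rewrite ler_wpM2r// invr_ge0 ltW.
have : \sum_(xi <- F) \sum_(i <- J xi) d i `^ s <= kappa * r `^ s.
  apply: (sums_le_disjoint lyr).
    move=> xi i xiF /(hJ _ xiF).1 [u [Uu bu]]; have [_ _ _ _ sub] := FQ _ xiF.
    by exists u; split => //; exact: sub.
  move=> xi xi' i xiF xiF' /(hJ _ xiF).1 hi /(hJ _ xiF').1 hi'.
  apply: contrapT => xx'.
  have [Qx rx px _ _] := FQ _ xiF; have [Qx' rx' px' _ _] := FQ _ xiF'.
  have := sep_ge x00 Qx Qx' xx' rx rx'.
  have := smallF _ _ xiF hi.
  case: hi => u []; rewrite ballEmdist/= => Uu xu.
  case: hi' => u' []; rewrite ballEmdist/= => Uu' xu'.
  have uu' := d_diam Uu Uu'.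
  have h1 := metric_triangle xi u xi'; have h2 := metric_triangle u u' xi'.
  rewrite (metric_sym u' xi') in h2.
  have -> : x0 / C = x0 / (4 * C) * 4 by field; rewrite gt_eqF.
  have -> : x0 / (2 * C) = x0 / (4 * C) * 2 by field; rewrite gt_eqF.
  lra.
apply/negP; rewrite -ltNge.
apply: (@lt_le_trans _ _ (th * #|` F|%:R)); last first.
  rewrite -sum_fset_const big_seq [leRHS]big_seq; apply: ler_sum => xi xiF.
  by rewrite ltW// (hJ _ xiF).2.
have th0 : 0 < th by rewrite mulr_gt0 ?kappa_gt0 ?powR_gt0 ?divr_gt0 ?powR_gt0.
apply: lt_le_trans (ler_wpM2l (ltW th0) cF).
have x0l : 0 <= x0 `^ l by exact: powR_ge0.
have E8 : 0 < (8 * C) `^ alpha by rewrite powR_gt0// mulr_gt0.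
have Eq : 0 < q `^ s by rewrite powR_gt0.
have Er : 0 < r `^ s by rewrite powR_gt0.
have Ex : 0 < x0 `^ (alpha - s * l) by rewrite powR_gt0.
have Exs : 0 < x0 `^ (s * l) by rewrite powR_gt0.
have Era : 0 < r `^ (alpha - s) by rewrite powR_gt0.
have -> : th = kappa * (x0 `^ (s * l) / q `^ s).
  by rewrite /th powR_div ?(ltW q0)// -powRrM (mulrC l).
have -> : (r / (8 * C * x0)) `^ alpha =
    r `^ (alpha - s) * r `^ s / ((8 * C) `^ alpha *
      (x0 `^ (alpha - s * l) * x0 `^ (s * l))).
  rewrite -!powRD ?subrK; last 2 first.
    by apply/implyP => _; rewrite gt_eqF.
    by apply/implyP => _; rewrite gt_eqF.
  have Cx0 : 0 < 8 * C * x0 by rewrite !mulr_gt0.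
  have C80 : 0 < 8 * C by rewrite mulr_gt0.
  by rewrite powR_div ?(ltW r0) ?(ltW Cx0)// powRM ?(ltW C80)// ltW.
move: x0le; rewrite ler_pdivlMr ?mulr_gt0 ?exprn_gt0//.
set a := x0 `^ (alpha - s * l); set w := x0 `^ (s * l).
set b := r `^ s; set c := r `^ (alpha - s); set g := (8 * C) `^ alpha.
set e := q `^ s => hle.
have k0 := kappa_gt0.
have -> : kappa * (w / e) * (c * b / (g * (a * w)) / C ^+ 2 / 2) =
    kappa * b * (2 * (c / (a * (4 * C ^+ 2 * g * e)))).
  by field; rewrite !gt_eqF.
rewrite ltr_pMr ?mulr_gt0//.
have : 1 <= c / (a * (4 * C ^+ 2 * g * e)).
  by rewrite ler_pdivlMr ?mul1r// !mulr_gt0// exprn_gt0.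
lra.
Qed.

Lemma annulus_child (xi : X) (p : R) (m : nat) : 0 < p -> p <= D -> exists y', forall x,
  ball y' (p / (3 * m.+1%:R)) x ->
  (1 - m.+1%:R^-1) * p <= mdist x xi /\ mdist x xi < p.
Proof.
move=> p0 pD; have m1 : 1 <= m.+1%:R :> R by rewrite ler1n.
pose u : R := m.+1%:R^-1 / 3.
have u0 : 0 < u by rewrite divr_gt0// invr_gt0 ltr0n.
have u1 : u <= 3^-1.
  by rewrite /u -[leRHS]mul1r ler_wpM2r// invf_le1// ltr0n.
have mE : m.+1%:R^-1 = 3 * u :> R by rewrite /u mulrC divfK.
have pE : p / (3 * m.+1%:R) = p * u by rewrite invfM [3^-1 * _]mulrC.
rewrite pE mE; clear pE mE.
have [|||y' [y'1 y'2]] := ann xi (a := p * (1 - 2 * u)) (b := p * (1 - u)).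
- by rewrite mulr_gt0//; lra.
- by rewrite ltr_pM2l//; lra.
- by apply: le_trans pD; rewrite ler_piMr ?(ltW p0)//; lra.
exists y' => x; rewrite ballEmdist/= (metric_sym x xi) => y'x.
have h7 := metric_triangle xi y' x; have h8 := metric_triangle xi x y'.
rewrite (metric_sym x y') in h8.
have -> : (1 - 3 * u) * p = p * (1 - 2 * u) - p * u by ring.
have e1 : p * (1 - u) = p - p * u by ring.
by rewrite e1 in y'2; split; lra.
Qed.

Lemma sparse_child t p q : 0 < p -> 0 < q -> 2 * C * p <= t ->
  sums_le [set xi | Q xi /\ rad xi <= t]
    (fun xi => (psi (rad xi) / rad xi) `^ alpha) (kappa / (2 * C * q) `^ alpha) ->
  sparse (2 * C * p) (p / q).
Proof.
move=> p0 q0 pt ht; have C2 : 0 < 2 * C by rewrite mulr_gt0.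
have Cq : 0 < (2 * C * q) `^ alpha by rewrite powR_gt0// mulr_gt0.
rewrite /sparse; have -> : kappa * (p / q) `^ alpha =
    (2 * C * p) `^ alpha * (kappa / (2 * C * q) `^ alpha).
  rewrite [RHS]mulrCA; congr (_ * _); rewrite powR_div ?(ltW p0) ?(ltW q0)//.
  rewrite (powRM _ (ltW C2) (ltW p0)) (powRM _ (ltW C2) (ltW q0)).
  by field; rewrite !gt_eqF// powR_gt0.
apply: (@sums_leM _ _ _ _ _ _ _ (powR_ge0 _ _) _
  (sums_leS (B := [set z | Q z /\ rad z <= 2 * C * p]) _ (lexx _) ht)).
  move=> z [Qz rz]; have z0 := rad_gt0 Qz; have pz := psi_rad_gt0 Qz.
  have pz' : 0 <= psi (rad z) / rad z by rewrite divr_ge0// ltW.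
  have Cp : 0 <= 2 * C * p by rewrite mulr_ge0// ltW.
  rewrite -(powRM _ Cp pz') ge0_ler_powR ?nnegrE ?(ltW alpha_gt0) ?(ltW pz)//.
    exact: mulr_ge0.
  by rewrite mulrCA ler_peMr ?(ltW pz)// ler_pdivlMr// mul1r.
by move=> z [Qz rz]; split => //; apply: le_trans rz _.
Qed.

Lemma psi_rad_candidate xi x0 : Q xi -> rad xi <= 2 * C ^+ 2 * x0 ->
  psi (rad xi) <= (8 * C * C ^+ 2)^-1 * rad xi ->
  8 * C * psi (rad xi) <= rad xi /\ psi (rad xi) <= x0 / (4 * C).
Proof.
move=> Qxi h2 h5; have C20 : 0 < C ^+ 2 by rewrite exprn_gt0.
have C21 : 1 <= C ^+ 2 by rewrite exprn_ege1.
have h0 := rad_gt0 Qxi.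
have h6 : 8 * C * psi (rad xi) <= rad xi / C ^+ 2.
  by move: h5; rewrite mulrC ler_pdivlMr ?mulr_gt0// ler_pdivlMr// => h5; lra.
split; first by apply: le_trans h6 _; rewrite ler_pdivrMr// ler_peMr// ltW.
rewrite ler_pdivlMr ?mulr_gt0//.
have : rad xi / C ^+ 2 <= 2 * x0 by rewrite ler_pdivrMr//; lra.
lra.
Qed.

Lemma near_series_point (x xi zeta : X) : Q xi -> Q zeta -> xi <> zeta ->
  8 * C * psi (rad xi) <= rad xi ->
  (rad zeta < rad xi -> 8 * C * psi (rad zeta) <= rad zeta) ->
  2 * C * psi (rad xi) < rad zeta ->
  mdist x xi < psi (rad xi) -> mdist x zeta < psi (rad zeta) ->
  rad xi <= 2 * C * psi (rad zeta).
Proof.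
move=> Qxi Qz xz h1 h2 h3 xxi xz'; have z0 := rad_gt0 Qz.
have xi0 := rad_gt0 Qxi.
have h7 := metric_triangle xi x zeta; rewrite (metric_sym xi x) in h7.
have : mdist xi zeta * C < (psi (rad xi) + psi (rad zeta)) * C.
  by rewrite ltr_pM2r//; lra.
have := sep Qxi Qz xz; rewrite mulrC ler_pdivrMr//.
have [zx|xz''] := ltP (rad zeta) (rad xi).
  by move=> h8 h9; have := h2 zx; lra.
by move=> h8 h9; lra.
Qed.

Lemma jump m y r t : 0 < r -> r <= D / 4 -> 0 < t -> light y r -> sparse t r ->
  exists xi y' r' t',
  [/\ [/\ 0 < r', r' <= r / 2, 0 < t' & t' <= t / 2],
      light y' r' /\ sparse t' r',
      ball y' r' `<=` ball y (r / 4),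
      [/\ Q xi, t' < rad xi, rad xi <= t & forall x, ball y' r' x ->
        (1 - m.+1%:R^-1) * psi (rad xi) <= mdist x xi /\
        mdist x xi < psi (rad xi)] &
      forall x zeta, ball y' r' x -> Q zeta -> t' < rad zeta -> rad zeta <= t ->
        zeta <> xi -> psi (rad zeta) <= mdist x zeta].
Proof.
move=> r0 rD t0 lyr spr.
have C20 : 0 < C ^+ 2 by rewrite exprn_gt0.
have e0 : 0 < (8 * C * C ^+ 2)^-1 by rewrite invr_gt0 !mulr_gt0.
have [t1 t10 ht1] := psi_rad_le e0.
pose q : R := 3 * m.+1%:R.
have q0 : 0 < q by rewrite mulr_gt0.
have [t2 t20 ht2] := series_tail (divr_gt0 kappa_gt0
  (powR_gt0 alpha (mulr_gt0 (mulr_gt0 (ltr0n R 2) C_gt0) q0))).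
have rD' : r <= D by have := D_gt0; lra.
have [t3 t30 ht3] := candidates y r0 rD'.
pose c := r `^ (alpha - s) / (4 * C ^+ 2 * (8 * C) `^ alpha * q `^ s).
have c0 : 0 < c.
  by rewrite divr_gt0 ?powR_gt0// ?mulr_gt0 ?powR_gt0 ?mulr_gt0.
have asl : 0 < alpha - s * l by rewrite subr_gt0.
pose T := Num.min (Num.min t1 t2) (Num.min t r).
have T0 : 0 < T by rewrite !lt_min t10 t20 t0 r0.
have [x0 [x00]] : exists x0 : R, [/\ 0 < x0,
    x0 < Num.min (Num.min t3 (c `^ (alpha - s * l)^-1)) (T / (2 * C ^+ 2))
    & x0 `^ l <= psi x0].
  by apply: psi_ge; rewrite !lt_min t30 powR_gt0// divr_gt0// mulr_gt0.
rewrite !lt_min => /andP[/andP[x0t3 x0c] x0T] x0psi.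
have {}x0T : 2 * C ^+ 2 * x0 <= T.
  by rewrite mulrC -ler_pdivlMr ?mulr_gt0// ltW.
have {}x0c : x0 `^ (alpha - s * l) <= c.
  rewrite -[leRHS](@powRr1 _ c) ?(ltW c0)// -(mulVf (lt0r_neq0 asl)) powRrM.
  by rewrite ge0_ler_powR ?nnegrE ?(ltW asl) ?(ltW x00) ?powR_ge0// ltW.
have Tt1 : T <= t1 by rewrite /T !ge_min lexx.
have Tt2 : T <= t2 by rewrite /T !ge_min lexx !orbT.
have Tt : T <= t by rewrite /T !ge_min lexx !orbT.
have Tr : T <= r by rewrite /T !ge_min lexx !orbT.
have [F [FQ cF]] := ht3 x0 x00 x0t3.
pose rho xi := psi (rad xi).
have psiC z : Q z -> rad z <= t1 -> 8 * C * rho z <= rad z.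
  move=> Qz zt1; apply: (@proj1 _ (rho z <= rad z / (2 * C ^+ 2) / (4 * C))).
  apply: psi_rad_candidate => //; last exact: ht1.
  by rewrite mulrC divfK// gt_eqF// mulr_gt0.
have psi_lt z : Q z -> rad z <= t1 -> rho z <= rad z.
  move=> Qz zt1; apply: le_trans (psiC z Qz zt1).
  by rewrite ler_peMl ?(ltW (psi_rad_gt0 Qz))//; have := C_ge1; lra.
have hF xi : xi \in F -> [/\ Q xi, x0 <= rad xi, rad xi <= T,
    rho xi <= x0 / (4 * C) & ball xi (rho xi) `<=` ball y (r / 4)].
  move=> /FQ[Qxi h1 h2 h3].
  have h4 : rad xi <= t1 by apply: le_trans Tt1; apply: le_trans x0T.
  split => //; first exact: le_trans x0T.
    by have [] := psi_rad_candidate Qxi h2 (ht1 _ Qxi h4).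
  by move=> z zr; apply: h3; apply: le_ball zr; exact: psi_lt.
have r4r : r / 4 <= r by lra.
have x0D : x0 <= D.
  apply: le_trans rD'; apply: le_trans Tr; apply: le_trans x0T.
  by rewrite ler_peMl ?(ltW x00)//; apply: mulr_ege1; rewrite ?exprn_ege1// ler1n.
pose hitU xi := exists i, [/\ hits y r i, x0 / (2 * C) <= d i &
  hits xi (rho xi) i].
pose hitQ xi := exists zeta, [/\ Q zeta /\ rad zeta <= t,
  x0 / (2 * C) <= psi (rad zeta) & mdist xi zeta <= x0 / (4 * C) + psi (rad zeta)].
pose Fa := [fset xi in F | `[< hitU xi >]]%fset.
pose Fb := [fset xi in F | `[< hitQ xi >]]%fset.
have cFa : #|` Fa|%:R <= (r / (8 * C * x0)) `^ alpha / C ^+ 2 / 4.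
  apply: (few_hit_cover r0 rD x00 x0D lyr) => xi.
  rewrite !inE/= => /andP[/hF[Qxi h1 _ h2 _] /asboolP[i [h3 h4 [u []]]]].
  rewrite ballEmdist/= => Uu xu; split => //; exists i; split => //.
  by exists u => //; apply: le_trans (ltW xu) h2.
have cFb : #|` Fb|%:R <= (r / (8 * C * x0)) `^ alpha / C ^+ 2 / 4.
  apply: (few_hit_series r0 rD x00 x0D spr) => xi.
  by rewrite !inE/= => /andP[/hF[Qxi h1 _ h2 _] /asboolP].
pose G := (F `\` (Fa `|` Fb))%fset.
have cG : (r / (8 * C * x0)) `^ alpha / C ^+ 2 / 2 <= #|` G|%:R.
  have : (#|` F| <= #|` G| + (#|` Fa| + #|` Fb|))%N.
    apply: (@leq_trans (#|` G| + #|` (Fa `|` Fb)%fset|)).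
      rewrite -(cardfsID (Fa `|` Fb)%fset F) addnC leq_add2l.
      by apply/fsubset_leq_card/fsubsetIr.
    by rewrite leq_add2l leq_card_fsetU.
  rewrite -(ler_nat R) !natrD; move: cF cFa cFb; lra.
have GF xi : xi \in G -> xi \in F by rewrite inE => /andP[].
have [xi xiG lightxi] : exists2 xi, xi \in G & sums_le (hits xi (rho xi))
    (fun i => d i `^ s) (kappa * (rho xi / q) `^ s).
  apply: (light_child r0 x00 q0 lyr x0c cG).
    move=> xi /GF/hF[? xr _ ? sub]; split => //.
      exact: le_trans x0psi (psi_mono x00 xr).
    by apply: subset_trans sub _; apply: le_ball.
  move=> xi i xiG hi; rewrite ltNge; apply/negP => di.
  have xiF := GF _ xiG; move: xiG; rewrite !inE/= xiF/= andbT => /negP; apply.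
  apply/orP; left; apply/asboolP; exists i; split => //.
  case: hi => u [Uu xu]; exists u; split => //.
  by have [_ _ _ _ sub] := hF _ xiF; exact: (le_ball r4r (sub _ xu)).
have xiF := GF _ xiG; have [Qxi h1 h2 h4 h6] := hF _ xiF.
have nhitQ : ~ hitQ xi.
  move=> h; move: xiG; rewrite !inE/= xiF/= andbT => /negP; apply.
  by apply/orP; right; apply/asboolP.
have h3 := psiC _ Qxi (le_trans h2 Tt1).
have p0 : 0 < rho xi := psi_rad_gt0 Qxi.
have p8 : 8 * rho xi <= 8 * C * rho xi.
  by rewrite ler_pM2r// ler_peMr.
have [|y' hy'] := annulus_child xi m p0.
  apply: le_trans (psi_lt _ Qxi (le_trans h2 Tt1)) _.
  exact: le_trans (le_trans h2 Tr) rD'.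
have pq : rho xi / q <= rho xi.
  rewrite ler_pdivrMr// ler_peMr ?(ltW p0)//.
  by apply: mulr_ege1; rewrite ler1n.
have rTt := le_trans h2 Tt; have rTr := le_trans h2 Tr.
exists xi, y', (rho xi / q), (2 * C * rho xi); split.
- split; rewrite ?divr_gt0 ?mulr_gt0//.
    by move: pq h3 p8 rTr; lra.
  by move: h3 rTt; lra.
- split.
    apply: sums_leS lightxi => // i [u [Uu /hy'[_ h]]].
    by exists u; split => //; rewrite ballEmdist/= metric_sym.
  apply: (sparse_child p0 q0 _ ht2).
  by move: h3 (le_trans h2 Tt2); lra.
- by move=> x /hy'[_ h]; apply: h6; rewrite ballEmdist/= metric_sym.
- by split => //; move: h3; lra.
- move=> x z /hy'[_ xxi] Qz tz zt zxi; rewrite leNgt; apply/negP => xz.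
  apply: nhitQ; exists z; split => //.
    rewrite ler_pdivrMr ?mulr_gt0// mulrC (le_trans h1)//.
    apply: (near_series_point Qxi Qz _ h3 _ tz xxi xz); first exact: not_eq_sym.
    by move=> zx; apply: psiC => //; apply: le_trans (ltW zx) (le_trans h2 Tt1).
  have h7 := metric_triangle xi x z; rewrite (metric_sym xi x) in h7.
  by move: h4 h7 xz xxi; rewrite -/(rho xi); lra.
Qed.

Definition admissible (st : stage R X) : Prop :=
  [/\ 0 < radius st, radius st <= D / 4, 0 < threshold st,
      light (center st) (radius st) & sparse (threshold st) (radius st)].

Definition refines m (st st' : stage R X) : Prop :=
  [/\ radius st' <= radius st / 2 /\ threshold st' <= threshold st / 2,
      ball (center st') (radius st') `<=` ball (center st) (radius st / 4),
      [/\ Q (target st'), threshold st' < rad (target st') &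
          rad (target st') <= threshold st],
      forall x, ball (center st') (radius st') x ->
        (1 - m.+1%:R^-1) * psi (rad (target st')) <= mdist x (target st') /\
        mdist x (target st') < psi (rad (target st')) &
      forall x zeta, ball (center st') (radius st') x -> Q zeta ->
        threshold st' < rad zeta -> rad zeta <= threshold st ->
        zeta <> target st' -> psi (rad zeta) <= mdist x zeta].

Lemma stage_sequence st0 : admissible st0 -> exists sq : nat -> stage R X,
  sq 0%N = st0 /\ forall n, admissible (sq n) /\ refines n (sq n) (sq n.+1).
Proof.
move=> v0.
have [f fP] : {f : nat * stage R X -> stage R X & forall p,
    admissible p.2 -> admissible (f p) /\ refines p.1 p.2 (f p)}.
  apply: (choice (P := fun p st' =>
    admissible p.2 -> admissible st' /\ refines p.1 p.2 st')).
  move=> [m st]; have [vst|nv] /= := pselect (admissible st); last by exists st.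
  case: (vst) => r0 rD t0 lyr spr.
  have [xi [y' [r' [t' [[r'0 r'r t'0 t't] [ly' sp'] sub [Qxi h1 h2 h3] h4]]]]] :=
    jump m r0 rD t0 lyr spr.
  exists (Stage y' r' t' xi) => _; split; split => //=.
  by apply: le_trans r'r _; lra.
pose sq := fix sq n := if n is n'.+1 then f (n', sq n') else st0.
have vsq n : admissible (sq n).
  by elim: n => //= n ih; case: (fP (n, sq n) ih).
by exists sq; split => // n; split => //; case: (fP (n, sq n) (vsq n)).
Qed.

Lemma first_stage : sums_le [set: nat] (fun i => d i `^ s) (kappa * (D / 8) `^ s) ->
  exists st0, admissible st0.
Proof.
move=> sumd; have C2 : 0 < 2 * C by rewrite mulr_gt0.
have D8 : 0 < D / 8 by rewrite divr_gt0.
have [t t0 ht] := series_tail kappa_gt0.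
pose p := Num.min (t / (2 * C)) (D / 8 / (2 * C)).
have p0 : 0 < p by rewrite lt_min !divr_gt0.
have pE : p / (p / (D / 8)) = D / 8.
  by field; rewrite !gt_eqF.
exists (Stage point (D / 8) (2 * C * p) point); split => //=.
- by have := D_gt0; lra.
- by rewrite !mulr_gt0.
- exact: sums_leS sumd.
- rewrite -[X in sparse _ X]pE; apply: (sparse_child (t := t)) => //.
  + by rewrite divr_gt0.
  + by rewrite mulrC -ler_pdivlMr// ge_min lexx.
  + apply: sums_leS ht => //; rewrite ler_pdivlMr; last first.
      by rewrite powR_gt0// mulr_gt0// divr_gt0.
    rewrite ler_piMr ?(ltW kappa_gt0)//.
    have le1 : 2 * C * (p / (D / 8)) <= 1.
      rewrite mulrC -ler_pdivlMr// ler_pdivrMr// ge_min; apply/orP; right.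
      by rewrite mul1r mulrC.
    apply: (@le_trans _ _ (1 `^ alpha)); last by rewrite powR1.
    rewrite ge0_ler_powR ?nnegrE ?(ltW alpha_gt0)//.
    by rewrite mulr_ge0 ?(ltW C2)// ltW// divr_gt0.
Qed.

Lemma escape (X_complete : forall F : set_system X, ProperFilter F -> cauchy F -> cvg F) :
  sums_le [set: nat] (fun i => d i `^ s) (kappa * (D / 8) `^ s) ->
  exists2 x, Eset Q rad psi x & forall i, ~ U i x.
Proof.
move=> /first_stage[st0 /stage_sequence[sq [_ sqP]]].
have r0 n : 0 < radius (sq n) by have [[]] := sqP n.
have t0 n : 0 < threshold (sq n) by have [[]] := sqP n.
have rhalf n : radius (sq n.+1) <= radius (sq n) / 2.
  by have [_ [[]]] := sqP n.
have thalf n : threshold (sq n.+1) <= threshold (sq n) / 2.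
  by have [_ [[]]] := sqP n.
have sub n : ball (center (sq n.+1)) (radius (sq n.+1)) `<=`
    ball (center (sq n)) (radius (sq n) / 4).
  by have [_ []] := sqP n.
have nest n k : ball (center (sq (n + k).+1)) (radius (sq (n + k).+1)) `<=`
    ball (center (sq n)) (radius (sq n) / 4).
  elim: k => [|k ih]; first by rewrite addn0.
  apply: subset_trans ih; rewrite addnS; apply: subset_trans (sub _) _.
  by apply: le_ball; have := r0 (n + k).+1; lra.
have centers n m : (n < m)%N -> ball (center (sq n)) (radius (sq n) / 4) (center (sq m)).
  move=> nm; rewrite -(subnKC nm) addSn; apply: nest.
  exact: ballxx.
have /cvg_ex[x cx] : cvg (center (sq n) @[n --> \oo]).
  apply: X_complete; apply: cauchy_exP => e e0.
  have [n nE] := halving_lt r0 rhalf e0.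
  exists (center (sq n)); exists n.+1 => // m /= /centers.
  by apply: le_ball; have := r0 n; lra.
have xin n : ball (center (sq n)) (radius (sq n)) x.
  have r2 : 0 < radius (sq n) / 2 by rewrite divr_gt0.
  have [N _ hN] := cvg_ball cx r2.
  have /= h1 := hN (maxn N n.+1) (leq_maxl _ _).
  have h2 := centers n (maxn N n.+1) (leq_maxr _ _).
  move: h1 h2; rewrite !ballEmdist/= => h1 h2.
  have := metric_triangle (center (sq n)) (center (sq (maxn N n.+1))) x.
  by rewrite (metric_sym (center (sq (maxn N n.+1))) x); have := r0 n; lra.
exists x; last first.
  move=> i Ux; have [n] := halving_lt r0 rhalf (d_gt0 i).
  apply/negP; rewrite -leNgt; have [[_ _ _ ly _] _] := sqP n.
  apply: (kappa_powR_le s_gt0) => //; first exact: ltW.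
  by apply: (sums_le_term ly); exists x; split => //; exact: xin.
split.
  move=> finW; have [|t t1 tF] :=
    fset_gt0_lower (F := fset_set [set xi | Q xi /\ mdist x xi < psi (rad xi)])
      (f := rad).
    by move=> xi; rewrite in_fset_set// inE => -[/rad_gt0].
  have [n tn] := halving_lt t0 thalf t1.
  have [_ [_ _ [Qt _ h1] h2 _]] := sqP n.
  have : threshold (sq n) < threshold (sq n).
    apply: lt_le_trans tn _; apply: le_trans h1; apply/ltW/tF.
    by rewrite in_fset_set// inE/=; split => //; case: (h2 x (xin n.+1)).
  by rewrite ltxx.
move=> [c /= /andP[c0 c1]]; apply.
have c10 : 0 < 1 - c by lra.
pose N := Num.truncn (1 - c)^-1.
apply: sub_finite_set (finite_large_rad (t0 N)) => zeta [Qz xz]; split => //.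
rewrite leNgt; apply/negP => zN.
have exn := halving_lt t0 thalf (rad_gt0 Qz).
case: (ex_minnP exn) => -[|n] tn minn.
  by have := halving_decr t0 thalf (leq0n N); lra.
have tzn : rad zeta <= threshold (sq n).
  by rewrite leNgt; apply/negP => /minn; rewrite ltnn.
have Nn : (N <= n)%N.
  rewrite leqNgt; apply/negP => nN.
  by have := halving_decr t0 thalf nN; lra.
have [_ [_ _ _ h1 h2]] := sqP n.
have pz := psi_rad_gt0 Qz.
have [zE|zne] := pselect (zeta = target (sq n.+1)); last first.
  have := h2 x zeta (xin n.+1) Qz tn tzn zne.
  have : c * psi (rad zeta) <= psi (rad zeta) by rewrite ler_piMl ?(ltW pz) ?(ltW c1).
  by move: xz; lra.
have [+ _] := h1 x (xin n.+1); rewrite -zE => h3.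
have h4 : n.+1%:R^-1 <= 1 - c.
  rewrite -[leRHS]invrK lef_pV2 ?posrE ?invr_gt0//.
  by apply: le_trans (ltW (truncnS_gt _)) _; rewrite ler_nat.
have h5 : c <= 1 - n.+1%:R^-1 by rewrite lerBrDr -lerBrDl.
have := le_lt_trans (le_trans (ler_wpM2r (ltW pz) h5) h3) xz.
by rewrite ltxx.
Qed.

End cantor_construction.

Lemma rad_band_sum (q : X) p n : alpha < p ->
  sums_le [set xi | [/\ (Q `&` ball q (D / 4)) xi, D / 8 * 2^-1 ^+ n.+1 < rad xi &
      rad xi <= D / 8 * 2^-1 ^+ n]]
    (fun xi => rad xi `^ p)
    (C ^+ 2 * (D / 2) `^ alpha * (2 * C) `^ alpha * 2 `^ p * (D / 16) `^ (p - alpha) *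
      (2^-1 `^ (p - alpha)) ^+ n).
Proof.
move=> ap F FA; have p0 := lt_trans alpha_gt0 ap.
pose u := D / 8 * 2^-1 ^+ n.+1.
have C2 : 0 < 2 * C by rewrite mulr_gt0.
have h2n : 0 < 2^-1 ^+ n :> R by rewrite exprn_gt0// invr_gt0.
have h2n1 : 2^-1 ^+ n <= 1 :> R by rewrite exprn_ile1// ?invr_ge0// invf_le1// ler1n.
have uE : u = D / 16 * 2^-1 ^+ n by rewrite /u exprS; field.
have D16 : 0 < D / 16 by rewrite divr_gt0.
have u0 : 0 < u by rewrite uE mulr_gt0.
have uD : u <= D / 16 by rewrite uE ler_piMr// ltW.
have e0 : 0 < u / (2 * C) by rewrite divr_gt0.
have ue : u / (2 * C) <= u.
  by rewrite ler_pdivrMr// ler_peMr ?(ltW u0)//; have := C_ge1; lra.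
have FQ xi : xi \in F -> [/\ Q xi, mdist q xi < D / 4, u <= rad xi & rad xi <= 2 * u].
  move=> /FA[[Qxi]]; rewrite ballEmdist/= => h1 h2 h3; split => //; first exact: ltW.
  by apply: le_trans h3 _; rewrite uE; lra.
have : #|` F|%:R * (u / (2 * C)) `^ alpha <= C ^+ 2 * (D / 2) `^ alpha.
  have D0 := D_gt0; apply: (packing C_gt0 ahl (v := q)) => //; try lra.
    move=> x y /FQ[Qx _ hx _] /FQ[Qy _ hy _] xy.
    apply: le_trans (sep_ge u0 Qx Qy xy hx hy).
    by rewrite le_eqVlt; apply/orP; left; apply/eqP; field; rewrite gt_eqF.
  move=> x /FQ[Qx qx _ _] z; rewrite !ballEmdist/= => xz.
  by have := metric_triangle q x z; lra.
rewrite -ler_pdivlMr ?powR_gt0// => cF.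
apply: (@le_trans _ _ (\sum_(xi <- F) (2 * u) `^ p)).
  rewrite big_seq [leRHS]big_seq; apply: ler_sum => xi /FQ[Qxi _ _ h].
  by rewrite ge0_ler_powR ?nnegrE ?(ltW p0)// ?(ltW (rad_gt0 Qxi))// mulr_ge0// ltW.
rewrite sum_fset_const mulrC.
apply: le_trans (ler_wpM2r (powR_ge0 _ _) cF) _.
rewrite le_eqVlt; apply/orP; left; apply/eqP.
rewrite (powR_div _ (ltW u0) (ltW C2)) (powRM p _ (ltW u0))//.
have -> : u `^ p = u `^ (p - alpha) * u `^ alpha.
  by rewrite -powRD ?subrK//; apply/implyP => _; rewrite gt_eqF.
have -> : u `^ (p - alpha) = (D / 16) `^ (p - alpha) * (2^-1 `^ (p - alpha)) ^+ n.
  rewrite uE (powRM _ (ltW D16) (ltW h2n)); congr (_ * _).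
  have h20 : 0 <= 2^-1 :> R by rewrite invr_ge0.
  by rewrite -(powR_mulrn n h20) -(powR_mulrn n (powR_ge0 _ _)) powRAC.
by field; rewrite !gt_eqF ?powR_gt0.
Qed.

Lemma local_rad_sum (q : X) p : alpha < p -> exists b,
  sums_le [set xi | (Q `&` ball q (D / 4)) xi /\ rad xi <= D / 8]
    (fun xi => rad xi `^ p) b.
Proof.
move=> ap; have hb n := rad_band_sum (q := q) (n := n) ap.
set K := (_ * (D / 16) `^ (p - alpha)) in hb.
have K0 : 0 <= K by rewrite /K !mulr_ge0 ?powR_ge0 ?(ltW C_gt0).
set th := 2^-1 `^ (p - alpha) in hb.
have th0 : 0 < th by rewrite powR_gt0// invr_gt0.
have th1 : th < 1.
  apply: (@lt_le_trans _ _ (1 `^ (p - alpha))); last by rewrite powR1.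
  by rewrite gt0_ltr_powR ?subr_gt0 ?nnegrE ?invr_ge0// invf_lt1// ltr1n.
exists (K * (1 - th)^-1).
have sumK : sums_le [set: nat] (fun n => K * th ^+ n) (K * (1 - th)^-1).
  by apply: sums_leM (sums_le_geometric th0 th1).
apply: sums_leS (sums_le_bigcup (fun n _ => hb n) sumK) => // xi [[Qxi qxi] rxi].
have r0 := rad_gt0 Qxi; pose u n := D / 8 * 2^-1 ^+ n : R.
have u0 n : 0 < u n by rewrite mulr_gt0 ?divr_gt0// exprn_gt0// invr_gt0.
have uhalf n : u n.+1 <= u n / 2.
  by rewrite /u exprS; lra.
case: (ex_minnP (halving_lt u0 uhalf r0)) => -[|n] un minn.
  by move: un; rewrite /u expr0 mulr1 ltNge rxi.
exists n => //; split => //.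
by rewrite leNgt; apply/negP => /minn; rewrite ltnn.
Qed.

Lemma Q_dense (x : X) e : 0 < e -> e <= D -> exists2 q, Q q & mdist x q < e.
Proof.
move=> e0 eD; have [t t0 h] := candidate x e0 eD.
have t2 : 0 < t / 2 by rewrite divr_gt0.
have [|xi [Qxi h1 _ sub]] := h (t / 2) t2; first by lra.
exists xi => //; have := sub xi (ballxx _ (lt_le_trans t2 h1)).
by rewrite ballEmdist/=; lra.
Qed.

Lemma hausdorff_measure_Wset0 s l : countable Q -> 0 < s -> alpha < l * s ->
  (exists2 t, 0 < t & forall x, 0 < x -> x < t -> psi x <= x `^ l) ->
  hausdorff_measure s (Wset Q rad psi) = 0.
Proof.
move=> Qc s0 als [t1 t10 psil]; apply: hausdorff_measure_eq0 => e e0.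
apply/lee_addgt0Pr => b b0; rewrite add0e.
have [t2 t20 psi2] := psi_rad_le ltr01.
pose t := Num.min (Num.min (t1 / 2) t2) (Num.min (D / 8) (e / 2)).
have t0 : 0 < t by rewrite !lt_min t20 !divr_gt0.
have psit xi : Q xi -> rad xi <= t ->
    [/\ psi (rad xi) <= rad xi `^ l, psi (rad xi) <= D / 8,
        rad xi <= D / 8 & 2 * psi (rad xi) <= e].
  move=> Qxi; rewrite !le_min => /andP[/andP[h1 h2] /andP[h3 h4]].
  have := psi2 _ Qxi h2; rewrite mul1r => h5; split => //.
  - by apply: psil; [exact: rad_gt0|lra].
  - exact: le_trans h5 h3.
  - lra.
have /countable_injP[f finj] := Qc.
pose eta (q : X) := b / 2 * 2^-1 ^+ f q.
have eta0 q : 0 < eta q by rewrite mulr_gt0 ?divr_gt0// exprn_gt0// invr_gt0.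
pose A (q : X) u := [set xi | ((Q `&` ball q (D / 4)) xi /\ rad xi <= t) /\ rad xi <= u].
have [u uP] : {u : X -> R & forall q, 0 < u q /\
    sums_le (A q (u q)) (fun xi => (2 * psi (rad xi)) `^ s) (eta q)}.
  apply: (choice (P := fun q u => 0 < u /\
    sums_le (A q u) (fun xi => (2 * psi (rad xi)) `^ s) (eta q))) => q.
  have [b' hb'] := local_rad_sum q als.
  have hA : sums_le [set xi | (Q `&` ball q (D / 4)) xi /\ rad xi <= t]
      (fun xi => (2 * psi (rad xi)) `^ s) (2 `^ s * b').
    apply: (sums_leM (g := fun xi => rad xi `^ (l * s))).
    - exact: powR_ge0.
    - move=> xi [[Qxi _] /(psit _ Qxi)[h _ _ _]].
      have pxi := psi_rad_gt0 Qxi.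
      rewrite (powRM _ (ler0n _ 2) (ltW pxi)) ler_wpM2l ?powR_ge0// powRrM.
      by rewrite ge0_ler_powR ?nnegrE ?powR_ge0 ?(ltW s0) ?(ltW pxi).
    - by apply: sums_leS hb' => // xi [[Qxi qxi] /(psit _ Qxi)[]].
  have [xi _|xi [[/rad_gt0]]|v v0 hv] := sums_le_tail (rad := rad) _ _ hA (eta0 q).
  - exact: powR_ge0.
  - by [].
  - by exists v.
pose K := \bigcup_(q in Q) A q (u q).
have KQ xi : K xi -> Q xi /\ rad xi <= t by move=> [q _ [[[Qxi _] ?] _]].
apply: (hausdorff_content_le (K := K) (r := fun xi => psi (rad xi))) => //.
- exact: ltW.
- exact: ltW.
- by apply: sub_countable Qc; apply: subset_card_le => xi /KQ[].
- move=> xi /KQ[Qxi /(psit _ Qxi)[_ _ _ h]]; split => //.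
  exact/ltW/psi_rad_gt0.
- move=> x Wx; have D8 : 0 < D / 8 by rewrite divr_gt0.
  have [|q Qq xq] := Q_dense x D8; first by have := D_gt0; lra.
  have v0 : 0 < Num.min t (u q) by rewrite lt_min t0 (uP q).1.
  have := infinite_setD Wx (finite_large_rad v0) => /infinite_setN0[xi [[Qxi xxi] nxi]].
  have : rad xi < Num.min t (u q).
    by rewrite ltNge; apply/negP => h; apply: nxi.
  rewrite lt_min => /andP[rt ru].
  have [_ p8 _ _] := psit _ Qxi (ltW rt).
  exists xi; last by rewrite ballEmdist/= metric_sym.
  exists q => //; split; last exact: ltW.
  split; last exact: ltW.
  split => //; rewrite ballEmdist/=.
  have := metric_triangle q x xi; rewrite (metric_sym q x); lra.
- apply: (sums_le_bigcup (e := eta)) => [q _|]; first exact: (uP q).2.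
  have -> : b = b / 2 * (1 - 2^-1)^-1 by field.
  apply: (sums_leM (g := fun q : X => 2^-1 ^+ f q)) => //.
    by rewrite divr_ge0// ltW.
  apply: (sums_le_reindex (A := [set: nat]) (f := fun n => 2^-1 ^+ n)) => //.
    by move=> x y Qx Qy fxy; apply: (finj x y) => //; rewrite inE.
  by apply: sums_le_geometric; lra.
Qed.

End well_distributed_sets.

(* The hypotheses [X_complete], [rad_bounded] (automatic when X is bounded) and
   [mu_neq0] are standing assumptions without each of which the claim fails. *)
Theorem theorem0p2 (R : realType) (X : pmetricType R)
  (mu : {measure set (borel X) -> \bar R})
  (alpha beta : R) (Q : set X) (rad : X -> R) (psi : R -> R)
  (X_complete : forall F : set_system X, ProperFilter F -> cauchy F -> cvg F)
  (mu_neq0 : mu [set: X] <> 0%E)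
  (alpha_gt0 : 0 < alpha) (beta_gt0 : 0 < beta)
  (mu_regular : regular mu alpha beta)
  (Q_countable : countable Q)
  (rad_gt0 : forall xi, Q xi -> 0 < rad xi)
  (rad_bounded : exists M : R, forall xi, Q xi -> rad xi <= M)
  (Q_WDS : WDS mu alpha Q rad)
  (psi_gt0 : forall t, 0 < t -> 0 < psi t)
  (psi_nondecreasing : forall s t, 0 < s -> s <= t -> psi s <= psi t)
  (psi_series :
    (\esum_(xi in Q) ((psi (rad xi) / rad xi) `^ alpha)%:E < +oo)%E) :
  hausdorff_dim (Eset Q rad psi) = hausdorff_dim (Wset Q rad psi) /\
  hausdorff_dim (Wset Q rad psi) = (alpha%:E / lower_order psi)%E.
Proof.
have [C1 [C10 ahl1 ann1]] := mu_regular.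
have [C2 [C21 sep2 wd2]] := Q_WDS.
have [M radM] := rad_bounded.
have C20 : 0 < C2 by lra.
have [x [y xy0]] := exists_mdist_gt0 alpha_gt0 C20 mu_neq0 wd2.
pose D := mdist x y; pose C := Num.max C1 C2.
have D0 : 0 < D := xy0.
have DX : (D%:E <= diam [set: X])%E by exact: le_diam.
have C1C : C1 <= C by rewrite /C le_max lexx.
have C2C : C2 <= C by rewrite /C le_max lexx orbT.
have C1' : 1 <= C := le_trans C21 C2C.
have ahl := ahlfors_ball_le C10 C1C DX ahl1.
have ann := annulus_neq0 C10 DX ann1.
have sep := well_separated_le C20 C2C rad_gt0 sep2.
have wd := well_distributed_le C20 C2C wd2.
have [S series_le] : exists S,
    sums_le Q (fun xi => (psi (rad xi) / rad xi) `^ alpha) S.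
  exists (fine (\esum_(xi in Q) ((psi (rad xi) / rad xi) `^ alpha)%:E)%E).
  apply/sums_le_esum => [xi _|]; first exact: powR_ge0.
  rewrite fineK// ge0_fin_numE//; apply: esum_ge0 => xi _.
  by rewrite lee_fin powR_ge0.
have L1 : (1%:E <= lower_order psi)%E.
  apply: lower_order_ge1 => //.
  exact: (psi_le_id alpha_gt0 C1' D0 ahl rad_gt0 radM wd psi_gt0
    psi_nondecreasing series_le).
have EW : Eset Q rad psi `<=` Wset Q rad psi by move=> z [].
have upper : (hausdorff_dim (Wset Q rad psi) <= alpha%:E / lower_order psi)%E.
  have L0 : (0 <= lower_order psi)%E by apply: le_trans L1; rewrite lee_fin.
  apply: hausdorff_dim_le => [|s s0 hs].
    by rewrite mule_ge0 ?inve_ge0// lee_fin ltW.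
  have [l lL als] : exists2 l, (l%:E < lower_order psi)%E & alpha < l * s.
    case: (lower_order psi) L1 hs => [r| |]//.
      rewrite !lee_fin => r1; have r0 : 0 < r by lra.
      rewrite inver gt_eqF// -EFinM lte_fin ltr_pdivrMr// => hs.
      have h : alpha / s < r by rewrite ltr_pdivrMr// mulrC.
      exists ((alpha / s + r) / 2); first by rewrite lte_fin; lra.
      by rewrite -ltr_pdivrMr//; lra.
    move=> _ _; exists (alpha / s + 1); first by rewrite ltry.
    by rewrite -ltr_pdivrMr// ltrDl.
  apply: (hausdorff_measure_Wset0 alpha_gt0 C1' D0 ahl rad_gt0 radM sep wd psi_gt0
    psi_nondecreasing series_le Q_countable s0 als).
  exact: (lt_lower_order psi_gt0 lL).
have positive s : 0 < s -> (s%:E < alpha%:E / lower_order psi)%E ->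
    hausdorff_measure s (Eset Q rad psi) <> 0%E.
  move=> s0 hs; have [l [lL sl ss]] : exists l,
      [/\ (lower_order psi < l%:E)%E, s * l < alpha & s <= alpha].
    case: (lower_order psi) L1 hs => [r| |]//; last first.
      by rewrite invey mule0 lte_fin => _ /(lt_trans s0); rewrite ltxx.
    rewrite !lee_fin => r1; have r0 : 0 < r by lra.
    rewrite inver gt_eqF// -EFinM lte_fin ltr_pdivlMr// => hs.
    have h : r < alpha / s by rewrite ltr_pdivlMr// mulrC.
    exists ((alpha / s + r) / 2); split; first by rewrite lte_fin; lra.
      by rewrite mulrC -ltr_pdivlMr//; lra.
    by apply: ltW; apply: le_lt_trans hs; rewrite ler_peMr// ltW.
  have psi_ge t := lower_order_lt psi_gt0 lL (t := t).
  apply: (hausdorff_measure_neq0_escape s0 (c := kappa alpha C * (D / 8) `^ s)).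
    by rewrite mulr_gt0 ?(kappa_gt0 _ C1')// powR_gt0// divr_gt0.
  move=> U d d0 dU; apply: (escape alpha_gt0 C1' D0 ahl rad_gt0 radM sep wd psi_gt0
    psi_nondecreasing series_le s0 ss sl d0 dU psi_ge ann X_complete).
have lower : (alpha%:E / lower_order psi <= hausdorff_dim (Eset Q rad psi))%E.
  apply: hausdorff_dim_ge => s; rewrite le_eqVlt => /orP[/eqP <-|]; last exact: positive.
  move=> h; apply: hausdorff_measure0_neq0.
  have [s' s'0 hs'] : exists2 s', 0 < s' & (s'%:E < alpha%:E / lower_order psi)%E.
    case: (alpha%:E / lower_order psi)%E h => [q| |]// q0.
      exists (q / 2); rewrite ?lte_fin in q0 *; lra.
    by exists 1; rewrite ?ltry.
  have [E0|] := eqVneq (Eset Q rad psi) set0; last by move/set0P.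
  by case: (positive s' s'0 hs'); rewrite E0 hausdorff_measure_set0.
have dimEW := le_hausdorff_dim EW.
split; apply/eqP; rewrite eq_le ?dimEW ?upper/=.
  exact: le_trans upper lower.
exact: le_trans lower dimEW.
Qed.
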